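(* Let $\mathbf{c}$ be a smooth closed Frenet curve of length $L$ in $\mathbb{R}^3$, with torsion $\tau$, such that $\tau$ is not identically zero and $\int_0^L \tau(s)\,ds = 2m\pi$ for some $m\in\mathbb{Z}$. Then there exists a germ of an oriented surface of class $C^r$, $r\ge 4$, containing $\mathbf{c}$ and having it as a hyperbolic principal cycle.
   Context: A closed Frenet curve of length $L$ is a smooth simple closed regular curve $c:[0,L]\to\mathbb{R}^3$, parametrized by arc length $s$ (and extended $L$-periodically), with curvature $k(s)>0$ everywhere; $\mathbf{c}=c([0,L])$. Its Frenet frame $\{t,n,b\}$, with $t=c'$, satisfies $t'=kn$, $n'=-kt+\tau b$, $b'=-\tau n$, where $\tau$ is the torsion. Let $\alpha:\mathbb{M}\to\mathbb{R}^3$ be a $C^r$ immersion ($r\ge 4$) of an oriented surface with positive unit normal $N_\alpha$, and fundamental forms $I_\alpha(v,w)=\langle D\alpha\, v,D\alpha\, w\rangle$, $II_\alpha(v,w)=\langle -DN_\alpha\, v,D\alpha\, w\rangle$. The principal curvatures at a point are the minimum and maximum of $II_\alpha$ on $I_\alpha$-unit tangent vectors, and principal directions are the directions where they are attained. The umbilic set $\mathcal{U}_\alpha$ is the set of points where the two principal curvatures coincide. On $\mathbb{M}\setminus\mathcal{U}_\alpha$ the minimal and maximal principal directions define two mutually orthogonal one-dimensional foliations, whose leaves are the principal curvature lines. A principal cycle is a closed principal curvature line (in particular it is disjoint from $\mathcal{U}_\alpha$). It is hyperbolic if the first derivative of its Poincaré return map, i.e. of the first return map on a transversal segment induced by the principal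 foliation to which the cycle belongs, evaluated at the point of the cycle, is different from $1$. A germ of a surface containing $\mathbf{c}$ is represented by a surface (here, regular and embedded) defined in some neighborhood of $\mathbf{c}$. *)

(* Defs.v *)
From HB Require Import structures.
From mathcomp Require Import all_boot all_order all_algebra.
From mathcomp Require Import all_classical all_reals all_analysis.
Set Implicit Arguments.
Unset Strict Implicit.
Unset Printing Implicit Defensive.
Import Order.TTheory GRing.Theory Num.Theory.
Import numFieldNormedType.Exports.
Local Open Scope classical_set_scope.
Local Open Scope ring_scope.

(* Shadow the notations of the formal derivative of polynomials. *)
Local Notation "f ^` ()" := (derive1 f) : ring_scope.
Local Notation "f ^` ( n )" := (derive1n n f) : ring_scope.

(* The library norm on row vectors is the sup norm, so all metric notions below
   go through [dotp] and [enorm]; the topology is the same. *)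
Definition dotp (R : realType) (n : nat) (u v : 'rV[R]_n) : R :=
  (u *m v^T) 0 0.

Definition enorm (R : realType) (n : nat) (u : 'rV[R]_n) : R :=
  Num.sqrt (dotp u u).

(* The indices i + 1 and i + 2 are taken in 'I_3, that is, modulo 3. *)
Definition crossp (R : realType) (u v : 'rV[R]_3) : 'rV[R]_3 :=
  \row_(i < 3) (u 0 (i + 1) * v 0 (i + 2) - u 0 (i + 2) * v 0 (i + 1)).

Section Curves.
Variables (R : realType) (c : R -> 'rV[R]_3).

Definition tangent : R -> 'rV[R]_3 := c^`().

Definition curvature (s : R) : R := enorm (tangent^`() s).

Definition principal_normal (s : R) : 'rV[R]_3 :=
  (curvature s)^-1 *: tangent^`() s.

Definition binormal (s : R) : 'rV[R]_3 :=
  crossp (tangent s) (principal_normal s).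

(* From b' = - tau n. *)
Definition torsion (s : R) : R :=
  - dotp (binormal^`() s) (principal_normal s).

End Curves.

(* The curve on [0, L] is given by its L-periodic extension. *)
Record closed_Frenet_curve (R : realType) (L : R) (c : R -> 'rV[R]_3) : Prop := {
  frenet_length_gt0 : 0 < L;
  frenet_smooth : forall (n : nat) (s : R), derivable (c^`(n)) s 1;
  frenet_periodic : forall s : R, c (s + L) = c s;
  frenet_simple : {in `[0, L[ &, injective c};
  frenet_arc_length : forall s : R, enorm (c^`() s) = 1;
  frenet_curvature_gt0 : forall s : R, 0 < curvature c s
}.

Section Surfaces.
Variable R : realType.

(* f is of class C^k on the open set U; quantifying over all directions v
   amounts to quantifying over the coordinate directions. *)
Fixpoint class_C (k : nat) (U : set 'rV[R]_2) (f : 'rV[R]_2 -> 'rV[R]_3) : Prop :=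
  (forall u, U u -> {for u, continuous f}) /\
  if k is k'.+1 then
    (forall u v, U u -> derivable f u v) /\
    (forall v, class_C k' U ('D_v f))
  else True.

(* x is a regular C^r parametrization, with domain U, of a relatively open part
   of S; x : U -> x(U) is a homeomorphism, with continuous inverse y. *)
Record local_parametrization (r : nat) (S : set 'rV[R]_3)
    (U : set 'rV[R]_2) (x : 'rV[R]_2 -> 'rV[R]_3) : Prop := {
  param_dom_open : open U;
  param_class : class_C r U x;
  param_immersion : forall u a, U u -> 'D_a x u = 0 -> a = 0;
  param_image_open : exists2 V : set 'rV[R]_3, open V & x @` U = V `&` S;
  param_homeo : exists2 y : 'rV[R]_3 -> 'rV[R]_2,
    {within x @` U, continuous y} & {in U, cancel x y}
}.

Definition param_normal (x : 'rV[R]_2 -> 'rV[R]_3) (u : 'rV[R]_2) : 'rV[R]_3 :=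
  let w := crossp ('D_(delta_mx 0 0) x u) ('D_(delta_mx 0 1) x u) in
  (enorm w)^-1 *: w.

(* A regular embedded surface of R^3 with an oriented atlas: all the charts
   induce the same unit normal, which is the positive one. Only the values of
   [positive_normal] on the surface are meaningful. *)
Record oriented_surface (r : nat) := OrientedSurface {
  support_of :> set 'rV[R]_3;
  atlas : set (set 'rV[R]_2 * ('rV[R]_2 -> 'rV[R]_3));
  positive_normal : 'rV[R]_3 -> 'rV[R]_3;
  atlas_param : forall U x, atlas (U, x) ->
    local_parametrization r support_of U x;
  atlas_cover : forall p, support_of p ->
    exists U x u, [/\ atlas (U, x), U u & x u = p];
  atlas_oriented : forall U x u, atlas (U, x) -> U u ->
    positive_normal (x u) = param_normal x u
}.

Section PrincipalFoliations.
Variables (r : nat) (S : oriented_surface r).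

Definition first_form (x : 'rV[R]_2 -> 'rV[R]_3) (u a b : 'rV[R]_2) : R :=
  dotp ('D_a x u) ('D_b x u).

Definition second_form (x : 'rV[R]_2 -> 'rV[R]_3) (u a b : 'rV[R]_2) : R :=
  dotp (- 'D_a (positive_normal S \o x) u) ('D_b x u).

(* e is a unit tangent vector of S at p, and II (e, e) = k. *)
Definition normal_curvature (p e : 'rV[R]_3) (k : R) : Prop :=
  exists U x u a, [/\ atlas S (U, x) /\ U u, x u = p, 'D_a x u = e,
    first_form x u a a = 1 & second_form x u a a = k].

Variant principal_kind := Minimal | Maximal.

Definition principal_curvature (kd : principal_kind) (p : 'rV[R]_3) (k : R) : Prop :=
  (exists e, normal_curvature p e k) /\
  (forall e' k', normal_curvature p e' k' ->
     match kd with Minimal => k <= k' | Maximal => k' <= k end).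

Definition umbilic (p : 'rV[R]_3) : Prop :=
  exists k, principal_curvature Minimal p k /\ principal_curvature Maximal p k.

(* v is a nonzero vector spanning a principal direction at p. *)
Definition principal_vector (kd : principal_kind) (p v : 'rV[R]_3) : Prop :=
  exists k e l, [/\ principal_curvature kd p k, normal_curvature p e k,
    l != 0 & v = l *: e].

(* A regular C^1 arc g on [a, b], of arbitrary speed, contained in a leaf of
   the principal foliation of kind kd. *)
Definition principal_arc (kd : principal_kind) (g : R -> 'rV[R]_3) (a b : R) : Prop :=
  {within `[a, b], continuous g^`()} /\
  forall t : R, t \in `[a, b] ->
    [/\ derivable g t 1, support_of S (g t), ~ umbilic (g t) &
        principal_vector kd (g t) (g^`() t)].

Definition principal_cycle (kd : principal_kind) (L : R) (c : R -> 'rV[R]_3) : Prop :=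
  [/\ 0 < L, forall s, c (s + L) = c s & principal_arc kd c 0 L].

(* sg, on [-d, d], is an embedded C^1 segment through p, everywhere transversal
   to the principal foliation of kind kd. *)
Definition transversal_segment (kd : principal_kind) (p : 'rV[R]_3)
    (sg : R -> 'rV[R]_3) (d : R) : Prop :=
  [/\ 0 < d, sg 0 = p, {in `[- d, d] &, injective sg},
      {within `[- d, d], continuous sg^`()} &
      forall w : R, w \in `[- d, d] ->
        [/\ derivable sg w 1, sg^`() w != 0, support_of S (sg w), ~ umbilic (sg w) &
            ~ principal_vector kd (sg w) (sg^`() w)]].

(* The leaf leaving sg w on the side of the vector v first meets the segment
   again at sg (P w). *)
Definition first_return (kd : principal_kind) (sg : R -> 'rV[R]_3) (d : R)
    (v : 'rV[R]_3) (P : R -> R) (w : R) : Prop :=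
  exists (T : R) (g : R -> 'rV[R]_3),
    [/\ 0 < T, principal_arc kd g 0 T, 0 < dotp (g^`() 0) v,
        [/\ g 0 = sg w, g T = sg (P w) & P w \in `[- d, d]] &
        forall t w' : R, t \in `]0, T[ -> w' \in `[- d, d] -> g t <> sg w'].

(* P is the Poincare return map, near the cycle, of a transversal segment through
   c s0, the leaves being followed in the direction of c. [P 0 = 0] says that the
   cycle returns to the segment at c s0 itself. P'(0) does not depend on
   the point s0 nor on the segment. *)
Definition hyperbolic (kd : principal_kind) (c : R -> 'rV[R]_3) : Prop :=
  exists (s0 d : R) (sg : R -> 'rV[R]_3) (P : R -> R),
    [/\ transversal_segment kd (c s0) sg d,
        \forall w \near (0 : R), w \in `[- d, d] /\
          first_return kd sg d (c^`() s0) P w,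
        P 0 = 0, derivable P 0 1 & P^`() 0 != 1].

Definition hyperbolic_principal_cycle (L : R) (c : R -> 'rV[R]_3) : Prop :=
  exists kd, principal_cycle kd L c /\ hyperbolic kd c.

End PrincipalFoliations.
End Surfaces.

(* Main.v *)
Require Import Defs.
From mathcomp Require Import all_boot all_order all_algebra.
From mathcomp Require Import all_classical all_reals all_analysis.
From mathcomp Require Import ring lra.
Set Implicit Arguments.
Unset Strict Implicit.
Unset Printing Implicit Defensive.
Import Order.TTheory GRing.Theory Num.Theory.
Import numFieldNormedType.Exports.
Local Open Scope classical_set_scope.
Local Open Scope ring_scope.
Local Notation "f ^` ()" := (derive1 f) : ring_scope.
Local Notation "f ^` ( n )" := (derive1n n f) : ring_scope.

(** The surface is a canal surface, that is, a union of circles along which a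
    one-parameter family of spheres touches it. On such a surface the circles are
    principal curves, and the other principal foliation is governed by a Riccati
    equation with the known solution c, hence is integrable by quadratures; so
    the Poincare map is explicit.

    Rotating the Frenet normal and binormal by an angle with derivative - tau
    gives unit normal fields W and N with W' = - kg t and N' = - kn t; they are
    L-periodic because the total torsion is a multiple of 2 pi
    ([exists_bishop_frame]). The initial angle is free, and since tau is not
    identically zero one can choose it so that the curvature kn is not constant.

    For periodic functions beta and gamma put K = gamma t + beta N and
      X = (l W + l^2 K) / (1 + l^2 |K|^2),      surf (s, l) = c (s) + X.
    For fixed s the curve l |-> surf (s, l) is the circle through c (s) with
    tangent W and curvature vector 2 K, the image of the line K + z W under the
    inversion centred at c (s), with l = 1 / z. If beta' = (2 beta - kn) gamma, then
    E1 = t - 2 gamma X, E2 = the unit vector along the l-derivative of surf and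
    E3 = N - 2 beta X form an orthonormal frame with E3 normal to the surface
    ([E_oframe], [is_derive_surf]) and, with g = kn - 2 beta, for every tangent
    vector a
      D_a E3 = - 2 beta D_a surf - (ds a) g E1
    ([is_derive_E3]). So the principal directions are E1 and E2, and the principal
    curvatures are 2 beta + g / speed and 2 beta, where speed is the component on
    E1 of the s-derivative of surf, equal to 1 on c ([normal_curvatureP]). With
    g > 0 the direction E1, tangent to c, is the maximal one.

    The curves tangent to E1 are the solutions of
      l' = - gamma (2 l - kg l^2),
    a linear equation in 1 / l ([is_derive_leaf_coord]). Over one period the
    solution starting at l = w ends at an explicit homography of w whose derivative
    at 0 is exp (- G), where G is the integral of 2 gamma. Now 2 gamma = (g' - kn') / g,
    and the choice g = exp (- kn') gives
    G = - \int kn' exp (kn') = \int kn' (1 - exp (kn')), which is negative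
    because kn is not constant ([holonomy_neq0]).

    There remains to see that a thin strip around c is embedded. This is a compactness
    argument: surf is locally injective along l = 0 ([locally_injective]), c is
    simple, and the injectivity of surf on a closed strip, modulo the period, makes it open
    onto its image ([injective_near_axis], [surf_open]). *)

(** * Directional derivatives and functions of class C^k *)

Section DirectionalCalculus.
Variables (R : realType) (V : normedModType R).
Implicit Types (f g : V -> R) (x v : V).

Lemma is_derive_lineP f x v d :
  is_derive x v f d <-> is_derive (0 : R) (1 : R) (fun h : R => f (h *: v + x)) d.
Proof.
have E : 'D_v f x = 'D_1 (fun h : R => f (h *: v + x)) 0.
  rewrite /derive; set g1 := fun h => h^-1 *: _; set g2 := fun h => h^-1 *: _.
  suff -> : g1 = g2 by [].
  by rewrite funeqE /g1 /g2 => h /=; rewrite addr0 scale0r add0r [_%:A]mulr1.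
split=> -[df <-].
- by apply: DeriveDef; [exact: (derivable1P f x v).1 df | rewrite E].
- by apply: DeriveDef; [exact: (derivable1P f x v).2 df | rewrite E].
Qed.

(** Restricting f to the line through x with direction v reduces this to the chain
    rule for functions of one variable. *)
Lemma is_derive_chain (h : R -> R) f x v d h' :
  is_derive (f x) (1 : R) h h' -> is_derive x v f d ->
  is_derive x v (fun y => h (f y)) (h' * d).
Proof.
move=> dh /is_derive_lineP df; apply/is_derive_lineP.
apply: (@is_derive1_comp R h (fun h0 => f (h0 *: v + x)) 0) => //.
by rewrite scale0r add0r.
Qed.

(** The rules below are in pointwise form, so that the derivative of an explicit
    formula can be assembled as a term. *)
Lemma is_deriveV' f x v d : f x != 0 -> is_derive x v f d ->
  is_derive x v (fun y => (f y)^-1) (- d / f x ^+ 2).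
Proof.
move=> fx0 [df <-]; split; first exact: derivableV.
by rewrite deriveV // [LHS]mulrC mulrN mulNr.
Qed.

Lemma is_deriveM' f g x v df dg : is_derive x v f df -> is_derive x v g dg ->
  is_derive x v (fun y => f y * g y) (df * g x + f x * dg).
Proof.
move=> hf hg; have := is_deriveM hf hg.
by move=> h; apply: (is_derive_eq h); rewrite addrC [g x *: _]mulrC.
Qed.

Lemma is_deriveD' f g x v df dg : is_derive x v f df -> is_derive x v g dg ->
  is_derive x v (fun y => f y + g y) (df + dg).
Proof. exact: is_deriveD. Qed.

Lemma is_deriveN' f x v df : is_derive x v f df -> is_derive x v (fun y => - f y) (- df).
Proof. exact: is_deriveN. Qed.

Lemma is_deriveB' f g x v df dg : is_derive x v f df -> is_derive x v g dg ->
  is_derive x v (fun y => f y - g y) (df - dg).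
Proof. exact: is_deriveB. Qed.

Lemma is_derive_cst' (r : R) x v : is_derive x v (fun=> r) 0.
Proof. exact: is_derive_cst. Qed.

End DirectionalCalculus.

Section ContinuouslyDifferentiable.
Variables (R : realType) (V : normedModType R).
Implicit Types (f g : V -> R) (k : nat).

(** The real-valued analogue of [class_C], over the whole space; it serves both for
    functions of the arc length and for functions on the parameter plane. *)
Fixpoint Ck k f : Prop :=
  continuous f /\
  if k is k'.+1 then
    (forall u v, derivable f u v) /\ (forall v, Ck k' ('D_v f))
  else True.

Lemma Ck_continuous k f : Ck k f -> continuous f.
Proof. by case: k => [|k] []. Qed.

Lemma Ck_derivable k f u v : Ck k.+1 f -> derivable f u v.
Proof. by case=> _ []. Qed.

Lemma Ck_derive k f v : Ck k.+1 f -> Ck k ('D_v f).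
Proof. by case=> _ [_]; apply. Qed.

Lemma Ck_is_derive k f u v : Ck k.+1 f -> is_derive u v f ('D_v f u).
Proof. by move=> Cf; apply: derivableP; exact: (@Ck_derivable k f u v Cf). Qed.

Lemma CkW k f : Ck k.+1 f -> Ck k f.
Proof.
elim: k f => [|k IH] f [cf [df Df]]; first by [].
by split=> //; split=> // v; apply: IH.
Qed.

Lemma Ck_le m k f : (m <= k)%N -> Ck k f -> Ck m f.
Proof.
move=> /subnKC <-; elim: (k - m)%N => [|i IH]; first by rewrite addn0.
by rewrite addnS => /CkW.
Qed.

Lemma CkS k f (df : V -> V -> R) : Ck k f ->
  (forall u v, is_derive u v f (df v u)) -> (forall v, Ck k (df v)) -> Ck k.+1 f.
Proof.
move=> Cf fdf Cdf; split; first exact: Ck_continuous Cf.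
split=> [u v|v]; first by have [] := fdf u v.
suff -> : 'D_v f = df v by [].
by apply/funext => u; have [] := fdf u v.
Qed.

Lemma Ck_cst k (a : R) : Ck k (fun _ => a).
Proof.
elim: k a => [|k IH] a; first by split=> // x; apply: cvg_cst.
by apply: (@CkS k _ (fun _ _ => 0)) => // u v; apply: is_derive_cst.
Qed.

Lemma CkD k f g : Ck k f -> Ck k g -> Ck k (fun x => f x + g x).
Proof.
elim: k f g => [|k IH] f g Cf Cg.
  split=> // x; apply: cvgD; [exact: (Ck_continuous Cf)|exact: (Ck_continuous Cg)].
apply: (@CkS k _ (fun v u => 'D_v f u + 'D_v g u)).
- by apply: IH; apply: CkW.
- move=> u v.
  by apply: is_deriveD; [exact: (Ck_is_derive _ _ Cf) | exact: (Ck_is_derive _ _ Cg)].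
- by move=> v; apply: IH; apply: Ck_derive.
Qed.

Lemma CkM k f g : Ck k f -> Ck k g -> Ck k (fun x => f x * g x).
Proof.
elim: k f g => [|k IH] f g Cf Cg.
  split=> // x; apply: cvgM; [exact: (Ck_continuous Cf)|exact: (Ck_continuous Cg)].
apply: (@CkS k _ (fun v u => 'D_v f u * g u + f u * 'D_v g u)).
- by apply: IH; apply: CkW.
- move=> u v.
  by apply: is_deriveM'; [exact: (Ck_is_derive _ _ Cf) | exact: (Ck_is_derive _ _ Cg)].
- by move=> v; apply: CkD; apply: IH; do ?[exact: Ck_derive | exact: CkW].
Qed.

Lemma CkN k f : Ck k f -> Ck k (fun x => - f x).
Proof.
move=> Cf; suff -> : (fun x => - f x) = (fun x => (-1) * f x).
  by apply: CkM => //; apply: Ck_cst.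
by apply/funext => x; rewrite mulN1r.
Qed.

Lemma CkB k f g : Ck k f -> Ck k g -> Ck k (fun x => f x - g x).
Proof. by move=> Cf Cg; apply: CkD => //; apply: CkN. Qed.

Lemma CkX k f n : Ck k f -> Ck k (fun x => f x ^+ n).
Proof.
move=> Cf; elim: n => [|n IH].
  by under eq_fun do rewrite expr0; apply: Ck_cst.
by under eq_fun do rewrite exprS; apply: CkM.
Qed.

Lemma CkV k f : (forall x, f x != 0) -> Ck k f -> Ck k (fun x => (f x)^-1).
Proof.
move=> f0; elim: k => [|k IH] Cf.
  by split=> // x; apply: cvgV => //; exact: (Ck_continuous Cf).
apply: (@CkS k _ (fun v u => - 'D_v f u * ((f u)^-1 * (f u)^-1))).
- by apply: IH; apply: CkW.
- move=> u v; rewrite -invfM -expr2.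
  by apply: is_deriveV' => //; exact: (Ck_is_derive _ _ Cf).
- move=> v; apply: CkM; first by apply: CkN; apply: Ck_derive.
  by apply: CkM; apply: IH; apply: CkW.
Qed.

Lemma Ck_expR k f : Ck k f -> Ck k (fun x => expR (f x)).
Proof.
elim: k => [|k IH] Cf.
  split=> // x; apply: continuous_comp; first exact: (Ck_continuous Cf).
  exact: continuous_expR.
apply: (@CkS k _ (fun v u => expR (f u) * 'D_v f u)).
- by apply: IH; apply: CkW.
- move=> u v; apply: is_derive_chain.
  by exact: (Ck_is_derive _ _ Cf).
- by move=> v; apply: CkM; [apply: IH; apply: CkW | apply: Ck_derive].
Qed.

(** The two statements are proved together, as each one is the derivative of the
    other. *)
Lemma Ck_sin_cos k f : Ck k f ->
  Ck k (fun x => sin (f x)) /\ Ck k (fun x => cos (f x)).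
Proof.
elim: k => [|k IH] Cf.
  split; split=> // x.
    apply: continuous_comp; first exact: (Ck_continuous Cf).
    exact: continuous_sin.
  apply: continuous_comp; first exact: (Ck_continuous Cf).
  exact: continuous_cos.
have [Cs Cc] := IH (CkW Cf).
have df u v : is_derive u v f ('D_v f u).
  by exact: (Ck_is_derive _ _ Cf).
split.
  apply: (@CkS k _ (fun v u => cos (f u) * 'D_v f u)) => // [u v|v].
    exact: is_derive_chain.
  by apply: CkM => //; apply: Ck_derive.
apply: (@CkS k _ (fun v u => - sin (f u) * 'D_v f u)) => // [u v|v].
  exact: is_derive_chain.
by apply: CkM; [apply: CkN | apply: Ck_derive].
Qed.

Lemma is_derive_sqrt' f u v d : 0 < f u -> is_derive u v f d ->
  is_derive u v (fun x => Num.sqrt (f x)) ((2 * Num.sqrt (f u))^-1 * d).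
Proof.
move=> fu df; apply: is_derive_chain df; exact: is_derive1_sqrt.
Qed.

Lemma Ck_sqrt k f : (forall x, 0 < f x) -> Ck k f ->
  Ck k (fun x => Num.sqrt (f x)).
Proof.
move=> f0; elim: k => [|k IH] Cf.
  split=> // x; apply: continuous_comp; first exact: (Ck_continuous Cf).
  exact: sqrt_continuous.
apply: (@CkS k _ (fun v u => (2 * Num.sqrt (f u))^-1 * 'D_v f u)).
- by apply: IH; apply: CkW.
- move=> u v; apply: is_derive_sqrt' => //.
  by exact: (Ck_is_derive _ _ Cf).
- move=> v; apply: CkM; last exact: Ck_derive.
  apply: CkV => [x|]; first by rewrite mulf_neq0 // gt_eqF // sqrtr_gt0.
  by apply: CkM; [apply: Ck_cst | apply: IH; apply: CkW].
Qed.

End ContinuouslyDifferentiable.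

Section OneVariable.
Variable R : realType.
Implicit Types f g : R -> R.

Lemma is_derive1Z f (u v d : R) :
  is_derive u (1 : R) f d -> is_derive u v f (d * v).
Proof.
move=> df; apply/is_derive_lineP.
apply: (@is_derive1_comp R f (fun h : R => h *: v + u) 0 d v).
  by rewrite scale0r add0r.
have h1 : is_derive (0 : R) (1 : R) (fun h : R => h * v) (1 * v + 0 * 0).
  exact: is_deriveM' (is_derive_id _ _) (is_derive_cst _ _ _).
have h2 := is_deriveD h1 (is_derive_cst u (0 : R) (1 : R)).
by apply: (is_derive_eq h2); rewrite mul1r mul0r !addr0.
Qed.

Lemma Ck_comp (V : normedModType R) k f (phi : V -> R) :
  Ck k f -> Ck k phi -> Ck k (fun x => f (phi x)).
Proof.
elim: k f phi => [|k IH] f phi Cf Cphi.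
  split=> // x; apply: continuous_comp.
    exact: (Ck_continuous Cphi).
  exact: (Ck_continuous Cf).
apply: (@CkS _ _ k _ (fun v u => 'D_1 f (phi u) * 'D_v phi u)).
- by apply: IH; apply: CkW.
- by move=> u v; apply: is_derive_chain; apply: Ck_is_derive; eassumption.
- move=> v; apply: CkM; last exact: Ck_derive.
  exact: IH (Ck_derive (1 : R) Cf) (CkW Cphi).
Qed.

Lemma is_derive_coord n (j : 'I_n) (u a : 'rV[R]_n) :
  is_derive u a (fun u : 'rV[R]_n => u 0 j) (a 0 j).
Proof.
have [/derivable_mxP dd dv] := is_derive_id u a; split; first exact: dd.
have : 'D_a id u 0 j = a 0 j by rewrite dv.
by rewrite derive_mx ?mxE //; apply/derivable_mxP.
Qed.

Lemma Ck_coord n k (j : 'I_n) : Ck k (fun u : 'rV[R]_n => u 0 j).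
Proof.
elim: k => [|k IH]; first by split=> // u; apply: coord_continuous.
apply: (@CkS R _ k _ (fun a _ : 'rV[R]_n => a 0 j)) => [//|u a|v].
  exact: is_derive_coord.
exact: Ck_cst.
Qed.

Lemma Ck1 k f f' : (forall s, is_derive s (1 : R) f (f' s)) -> Ck k f' ->
  Ck k.+1 f.
Proof.
move=> df Cf'; have Cf : forall m, (m <= k)%N -> Ck m f.
  elim=> [|m IH] mk.
    split=> // s; apply: differentiable_continuous.
    by apply/derivable1_diffP; have [] := df s.
  apply: (@CkS _ _ m _ (fun v u => f' u * v)).
  - by apply: IH; apply: ltnW.
  - by move=> u v; apply: is_derive1Z.
  - move=> v; apply: CkM; last exact: Ck_cst.
    exact: Ck_le (ltnW mk) Cf'.
apply: (@CkS _ _ k _ (fun v u => f' u * v)).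
- exact: Cf.
- by move=> u v; apply: is_derive1Z.
- by move=> v; apply: CkM => //; exact: Ck_cst.
Qed.

End OneVariable.

Section RowVectors.
Variables (R : realType) (V : normedModType R) (n : nat).
Implicit Types M : V -> 'rV[R]_n.

Lemma is_derive_rowP M x v (D : 'rV[R]_n) :
  is_derive x v M D <-> forall j, is_derive x v (fun y => M y 0 j) (D 0 j).
Proof.
split=> [[dM <-] j|dM].
  split; first by have /derivable_mxP := dM; apply.
  by rewrite derive_mx // mxE.
have dM' : derivable M x v.
  by apply/derivable_mxP => i j; rewrite ord1; have [] := dM j.
split=> //; rewrite derive_mx //; apply/rowP => j; rewrite mxE.
by have [] := dM j.
Qed.

Lemma continuous_rowP M x :
  (forall j, {for x, continuous (fun y => M y 0 j)}) -> {for x, continuous M}.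
Proof.
move=> cM; apply/cvgrPdist_le => /= e e0.
near=> y.
rewrite /Num.Def.normr/= mx_normrE (bigmax_le _ (ltW e0))//= => -[i j] _.
rewrite !mxE/= ord1.
move: j; near: y; apply: filter_forall => /= j.
exact: ((cvgrPdist_le _ _).1 (cM j)).
Unshelve. all: by end_near. Qed.

End RowVectors.

Lemma class_C_coord (R : realType) (f : 'rV[R]_2 -> 'rV[R]_3) k U :
  (forall j, Ck k (fun u => f u 0 j)) -> class_C k U f.
Proof.
elim: k f => [|k IH] f Cf.
  by split=> // u _; apply: continuous_rowP => j; apply: (Ck_continuous (Cf j)).
split.
  by move=> u _; apply: continuous_rowP => j; apply: (Ck_continuous (Cf j)).
have df u v : derivable f u v.
  by apply/derivable_mxP => i j; rewrite ord1; apply: (@Ck_derivable _ _ k _ u v (Cf j)).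
split=> // v; apply: IH => j.
have -> : (fun u => 'D_v f u 0 j) = 'D_v (fun u => f u 0 j).
  by apply/funext => u; rewrite derive_mx // mxE.
exact: Ck_derive.
Qed.

Lemma Ck_curve (R : realType) n (c : R -> 'rV[R]_n) :
  (forall m s, derivable (c^`(m)) s 1) -> forall k j, Ck k (fun s => c s 0 j).
Proof.
move=> dc k j; elim: k c dc j => [|k IH] c dc j.
  split=> // s; apply: differentiable_continuous; apply/derivable1_diffP.
  by have /derivable_mxP := dc 0%N s; apply.
apply: (@Ck1 _ _ _ (fun s => c^`() s 0 j)).
  move=> s; move: j; apply/is_derive_rowP.
  by apply: DeriveDef; [exact: (dc 0%N s) | rewrite derive1E].
by apply: IH => m s; rewrite -derive1Sn.
Qed.

(** * Primitives of continuous functions *)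

Section Primitives.
Variable R : realType.
Implicit Types f F : R -> R.
Local Notation mu := (@lebesgue_measure R).

Lemma Rintegral_primitive f F (a b : R) : a < b -> continuous f ->
  (forall s, is_derive s (1 : R) F (f s)) ->
  \int[mu]_(x in `[a, b]) f x = F b - F a.
Proof.
move=> ab cf dF.
have cF : continuous F.
  move=> s; apply: differentiable_continuous.
  by apply/derivable1_diffP; have [] := dF s.
rewrite /Rintegral (@continuous_FTC2 R f F a b) //.
- exact: continuous_subspaceT.
- split.
  + by move=> x _; have [] := dF x.
  + exact/cvg_at_right_filter/cF.
  + exact/cvg_at_left_filter/cF.
- by move=> x _; rewrite derive1E; have [] := dF x.
Qed.

(** The primitive on the whole line is \int_0^x f, written as a difference of two
    integrals with a common left end point, smaller than x and 0. *)
Lemma exists_primitive f : continuous f ->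
  exists F, forall s, is_derive s (1 : R) F (f s).
Proof.
move=> cf.
pose I a b : R := \int[mu]_(x in `[a, b]) f x.
have fi (a b : R) : mu.-integrable `[a, b] (EFin \o f).
  apply: continuous_compact_integrable; first exact: segment_compact.
  exact: continuous_subspaceT.
have dI (a x : R) : a < x -> is_derive x (1 : R) (I a) (f x).
  move=> ax.
  have [dI eI] := @continuous_FTC1_closed R f a x (x + 1)
    (ltr_pwDr ltr01 (lexx x)) (fi _ _) ax (cf x).
  by split; rewrite -?derive1E.
have addI (a b x : R) : a <= b -> b <= x -> I a x = I a b + I b x.
  move=> ab bx; apply/eqP; rewrite addrC -subr_eq; apply/eqP.
  rewrite /I Rintegral_itvB ?bnd_simp //; apply: Rintegral_itv_obnd_cbnd.
  by apply: integrableS (fi b x) => //; apply: subset_itvr; rewrite bnd_simp.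
have indep (a b x : R) : a <= b -> b <= x -> b <= 0 -> I a x - I a 0 = I b x - I b 0.
  by move=> ab bx b0; rewrite (addI a b x) // (addI a b 0) //; ring.
(* The left end point moves with x, but is locally dominated by a fixed one. *)
exists (fun x => I (- (`|x| + 1)) x - I (- (`|x| + 1)) 0) => s.
have ltNn (e x : R) : 0 < e -> - (`|x| + e) < x.
  by move=> e0; have := ler_norm (- x); rewrite normrN; lra.
have d1 : is_derive s (1 : R) (fun x => I (- (`|s| + 2)) x - I (- (`|s| + 2)) 0) (f s).
  have := is_deriveB (dI (- (`|s| + 2)) s (ltNn _ _ _))
    (is_derive_cst (I (- (`|s| + 2)) 0) s (1 : R)).
  by rewrite subr0; apply; lra.
apply: near_eq_is_derive d1; near=> x.
have xs : `|x| < `|s| + 1.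
  have : `|s - x| < 1 by near: x; apply: cvgr_dist_lt.
  by have := ler_normB s (s - x); rewrite opprB addrC subrK; lra.
apply: indep; first by lra.
  by rewrite ltW // ltNn.
by have := normr_ge0 x; lra.
Unshelve. all: by end_near. Qed.

Lemma exists_primitive0 f : continuous f ->
  exists F, (forall s, is_derive s (1 : R) F (f s)) /\ F 0 = 0.
Proof.
move=> /exists_primitive[F dF]; exists (fun s => F s - F 0); split; last by rewrite subrr.
move=> s; have h := is_deriveB' (dF s) (is_derive_cst' (F 0) s 1).
by apply: (is_derive_eq h); rewrite subr0.
Qed.

Lemma primitive_increment f F (T : R) : trigo.periodic f T ->
  (forall s, is_derive s (1 : R) F (f s)) ->
  forall s s', F (s + T) - F s = F (s' + T) - F s'.
Proof.
move=> pf dF.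
pose H x := F (x + T) - F x.
suff dH x : is_derive x (1 : R) H 0.
  by move=> s s'; rewrite -/(H s) -/(H s'); apply: is_derive_0_is_cst.
have dT : is_derive x (1 : R) (fun x : R => x + T) (1 + 0).
  exact: is_deriveD' (is_derive_id x (1 : R)) (is_derive_cst' T x 1).
have dFT := @is_derive_chain _ _ F (fun x : R => x + T) x 1 _ _ (dF (x + T)) dT.
by apply: (is_derive_eq (is_deriveB' dFT (dF x))); rewrite pf; ring.
Qed.

End Primitives.

(** * Oriented orthonormal frames of R^3 *)

Section EuclideanSpace.
Variable R : realType.
Implicit Types u v w e : 'rV[R]_3.

Lemma row3P u v :
  u 0 0 = v 0 0 -> u 0 1 = v 0 1 -> u 0 2 = v 0 2 -> u = v.
Proof.
move=> h0 h1 h2; apply/rowP => -[[|[|[|i]]] hi] //.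
- by rewrite (_ : Ordinal hi = 0) //; apply: val_inj.
- by rewrite (_ : Ordinal hi = 1) //; apply: val_inj.
- by rewrite (_ : Ordinal hi = 2) //; apply: val_inj.
Qed.

Lemma dotpE u v : dotp u v = u 0 0 * v 0 0 + u 0 1 * v 0 1 + u 0 2 * v 0 2.
Proof.
rewrite /dotp mxE !big_ord_recr big_ord0 /= add0r !mxE.
by congr (_ * _ + _ * _ + _ * _); congr (_ _ _); apply: val_inj.
Qed.

Lemma crosspE u v :
  [/\ crossp u v 0 0 = u 0 1 * v 0 2 - u 0 2 * v 0 1,
      crossp u v 0 1 = u 0 2 * v 0 0 - u 0 0 * v 0 2 &
      crossp u v 0 2 = u 0 0 * v 0 1 - u 0 1 * v 0 0].
Proof.
split; rewrite mxE.
- by congr (_ * _ - _ * _); congr (_ _ _); apply: val_inj.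
- by congr (_ * _ - _ * _); congr (_ _ _); apply: val_inj.
- by congr (_ * _ - _ * _); congr (_ _ _); apply: val_inj.
Qed.

Lemma dotpC u v : dotp u v = dotp v u.
Proof. by rewrite !dotpE; ring. Qed.

Lemma dotp_ge0 u : 0 <= dotp u u.
Proof. by rewrite dotpE; nra. Qed.

Lemma dotpZl (a : R) u v : dotp (a *: u) v = a * dotp u v.
Proof. by rewrite !dotpE !mxE; ring. Qed.

Lemma dotpZr (a : R) u v : dotp u (a *: v) = a * dotp u v.
Proof. by rewrite dotpC dotpZl dotpC. Qed.

Lemma dotpNl u w : dotp (- u) w = - dotp u w.
Proof. by rewrite !dotpE !mxE; ring. Qed.

Definition oframe e1 e2 e3 : Prop :=
  [/\ dotp e1 e1 = 1, dotp e2 e2 = 1, dotp e1 e2 = 0 & e3 = crossp e1 e2].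

Definition comb e1 e2 e3 (a b d : R) := a *: e1 + b *: e2 + d *: e3.

Lemma combE e1 e2 e3 a b d j :
  comb e1 e2 e3 a b d 0 j = a * e1 0 j + b * e2 0 j + d * e3 0 j.
Proof. by rewrite /comb !mxE. Qed.

Section Frame.
Variables e1 e2 e3 : 'rV[R]_3.
Hypothesis fr : oframe e1 e2 e3.

Lemma oframe_dotp :
  [/\ dotp e1 e1 = 1, dotp e2 e2 = 1 & dotp e3 e3 = 1] /\
  [/\ dotp e1 e2 = 0, dotp e1 e3 = 0 & dotp e2 e3 = 0].
Proof.
have [h1 h2 h12 ->] := fr.
have [c0 c1 c2] := crosspE e1 e2.
split; split => //; move: h1 h2 h12; rewrite !dotpE c0 c1 c2.
- set x0 := e1 0 0; set x1 := e1 0 1; set x2 := e1 0 2.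
  set y0 := e2 0 0; set y1 := e2 0 1; set y2 := e2 0 2 => h1 h2 h12.
  have -> : (x1 * y2 - x2 * y1) * (x1 * y2 - x2 * y1) +
    (x2 * y0 - x0 * y2) * (x2 * y0 - x0 * y2) +
    (x0 * y1 - x1 * y0) * (x0 * y1 - x1 * y0) =
    (x0 * x0 + x1 * x1 + x2 * x2) * (y0 * y0 + y1 * y1 + y2 * y2) -
    (x0 * y0 + x1 * y1 + x2 * y2) * (x0 * y0 + x1 * y1 + x2 * y2) by ring.
  by rewrite h1 h2 h12; ring.
- by move=> *; ring.
- by move=> *; ring.
Qed.

Lemma dotp_comb a b d a' b' d' :
  dotp (comb e1 e2 e3 a b d) (comb e1 e2 e3 a' b' d') = a * a' + b * b' + d * d'.
Proof.
have [[h1 h2 h3] [h12 h13 h23]] := oframe_dotp.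
have -> : dotp (comb e1 e2 e3 a b d) (comb e1 e2 e3 a' b' d') =
  a * a' * dotp e1 e1 + b * b' * dotp e2 e2 + d * d' * dotp e3 e3 +
  (a * b' + b * a') * dotp e1 e2 + (a * d' + d * a') * dotp e1 e3 +
  (b * d' + d * b') * dotp e2 e3 by rewrite !dotpE !combE; ring.
by rewrite h1 h2 h3 h12 h13 h23; ring.
Qed.

Lemma dotp_comb1 a b d : dotp (comb e1 e2 e3 a b d) e1 = a.
Proof.
have := dotp_comb a b d 1 0 0.
rewrite [in X in dotp _ X]/comb scale1r !scale0r !addr0 => ->.
by rewrite mulr1 !mulr0 !addr0.
Qed.

Lemma crossp_crossp u v w :
  crossp u (crossp v w) = dotp u w *: v - dotp u v *: w.
Proof.
have [c0 c1 c2] := crosspE v w.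
have [d0 d1 d2] := crosspE u (crossp v w).
by apply: row3P; rewrite ?d0 ?d1 ?d2 ?c0 ?c1 ?c2 !mxE !dotpE; ring.
Qed.

Lemma crosspC u v : crossp u v = - crossp v u.
Proof.
have [c0 c1 c2] := crosspE v u.
have [d0 d1 d2] := crosspE u v.
by apply: row3P; rewrite ?d0 ?d1 ?d2 mxE ?c0 ?c1 ?c2; ring.
Qed.

Lemma oframe_crossp : crossp e2 e3 = e1 /\ crossp e3 e1 = e2.
Proof.
have [h1 h2 h12 ->] := fr; split.
  by rewrite crossp_crossp h2 dotpC h12 scale1r scale0r subr0.
by rewrite crosspC crossp_crossp h1 h12 scale1r scale0r sub0r opprK.
Qed.

Lemma crossp_comb a b d a' b' d' :
  crossp (comb e1 e2 e3 a b d) (comb e1 e2 e3 a' b' d') =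
  comb e1 e2 e3 (b * d' - d * b') (d * a' - a * d') (a * b' - b * a').
Proof.
have [h23 h31] := oframe_crossp; have [_ _ _ h12] := fr.
have -> : crossp (comb e1 e2 e3 a b d) (comb e1 e2 e3 a' b' d') =
  comb (crossp e2 e3) (crossp e3 e1) (crossp e1 e2)
     (b * d' - d * b') (d * a' - a * d') (a * b' - b * a').
  have [a0 a1 a2] := crosspE e2 e3; have [b0 b1 b2] := crosspE e3 e1.
  have [c0 c1 c2] := crosspE e1 e2.
  have [d0 d1 d2] := crosspE (comb e1 e2 e3 a b d) (comb e1 e2 e3 a' b' d').
  by apply: row3P;
    rewrite ?d0 ?d1 ?d2 !combE ?a0 ?a1 ?a2 ?b0 ?b1 ?b2 ?c0 ?c1 ?c2; ring.
by rewrite h23 h31 -h12.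
Qed.

(** The matrix with rows e1, e2, e3 has its transpose as a right inverse, hence
    also as a left inverse. *)
Lemma comb_dotp v : v = comb e1 e2 e3 (dotp v e1) (dotp v e2) (dotp v e3).
Proof.
pose M : 'M[R]_3 :=
  \matrix_(i, j) (if i == 0 then e1 0 j else if i == 1 then e2 0 j else e3 0 j).
have [[h1 h2 h3] [h12 h13 h23]] := oframe_dotp.
have MM : M *m M^T = 1%:M.
  apply/matrixP => i j.
  have -> : (M *m M^T) i j = dotp (row i M) (row j M).
    by rewrite /dotp !mxE; apply: eq_bigr => k _; rewrite !mxE.
  have rM k : row k M = if k == 0 then e1 else if k == 1 then e2 else e3.
    by apply/rowP => l; rewrite !mxE; case: ifP => // _; case: ifP.
  rewrite !rM !mxE.
  case: i => -[|[|[|//]]] hi; case: j => -[|[|[|//]]] hj //=;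
    rewrite ?h1 ?h2 ?h3 ?h12 ?h13 ?h23 // dotpC ?h12 ?h13 ?h23 //.
have MM' := mulmx1C MM.
have E := congr1 (fun X => v *m X) MM'.
rewrite mulmx1 mulmxA in E; rewrite -{1}E.
apply/rowP => j; rewrite combE mxE !big_ord_recr big_ord0 /= add0r !mxE /=.
congr (_ * _ + _ * _ + _ * _); rewrite /dotp !mxE;
  by apply: eq_bigr => k _; rewrite !mxE.
Qed.

Lemma comb_inj a b d a' b' d' :
  comb e1 e2 e3 a b d = comb e1 e2 e3 a' b' d' -> [/\ a = a', b = b' & d = d'].
Proof.
move=> E.
have h x y z : dotp (comb e1 e2 e3 a b d) (comb e1 e2 e3 x y z) =
               dotp (comb e1 e2 e3 a' b' d') (comb e1 e2 e3 x y z) by rewrite E.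
have := h 1 0 0; have := h 0 1 0; have := h 0 0 1.
by rewrite !dotp_comb !mulr0 !mulr1 !addr0 !add0r => -> -> ->.
Qed.

End Frame.

Lemma is_derive_dotp (V : normedModType R) (f g : V -> 'rV[R]_3)
    (x v : V) (df dg : 'rV[R]_3) :
  is_derive x v f df -> is_derive x v g dg ->
  is_derive x v (fun y => dotp (f y) (g y)) (dotp df (g x) + dotp (f x) dg).
Proof.
move=> /is_derive_rowP hf /is_derive_rowP hg.
have -> : (fun y => dotp (f y) (g y)) = (fun y =>
    f y 0 0 * g y 0 0 + f y 0 1 * g y 0 1 + f y 0 2 * g y 0 2).
  by apply/funext => y; exact: dotpE.
have h j := is_deriveM' (hf j) (hg j).
apply: (is_derive_eq (is_deriveD (is_deriveD (h 0) (h 1)) (h 2))).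
by rewrite !dotpE; ring.
Qed.

End EuclideanSpace.

(** * The parameter plane *)

Section ParameterPlane.
Variable R : realType.
Implicit Types u v : 'rV[R]_2.

Lemma near0_norm_lt (e : R) : 0 < e -> \forall w \near (0 : R), `|w| < e.
Proof.
move=> e0; apply/nbhs_ballP; exists e => // w.
by rewrite /ball /= sub0r normrN.
Qed.

Definition pt (s l : R) : 'rV[R]_2 := \row_j (if j == 0 then s else l).

Lemma pt0 s l : pt s l 0 0 = s. Proof. by rewrite mxE. Qed.
Lemma pt1 s l : pt s l 0 1 = l. Proof. by rewrite mxE. Qed.

Lemma pt_inj s l s' l' : pt s l = pt s' l' -> s = s' /\ l = l'.
Proof.
move=> e; split; first by rewrite -[LHS](pt0 s l) e pt0.
by rewrite -[LHS](pt1 s l) e pt1. Qed.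

Lemma row2P u v : u 0 0 = v 0 0 -> u 0 1 = v 0 1 -> u = v.
Proof.
move=> h0 h1; apply/rowP => -[[|[|i]] hi] //.
- by rewrite (_ : Ordinal hi = 0) //; apply: val_inj.
- by rewrite (_ : Ordinal hi = 1) //; apply: val_inj.
Qed.

Lemma nbhs_row2P u (A : set 'rV[R]_2) : nbhs u A <->
  exists2 e : R, 0 < e &
    forall v, `|v 0 0 - u 0 0| < e -> `|v 0 1 - u 0 1| < e -> A v.
Proof.
split=> [/nbhs_ballP[e e0 eA]|[e e0 eA]].
  exists e => // v h0 h1; apply: eA; split=> // i j; rewrite ord1.
  case: j => -[|[|j]] hj //.
  - rewrite (_ : Ordinal hj = 0); last exact: val_inj.
    by rewrite /ball /= distrC.
  - rewrite (_ : Ordinal hj = 1); last exact: val_inj.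
    by rewrite /ball /= distrC.
apply/nbhs_ballP; exists e => // v [_ vu]; apply: eA; rewrite distrC.
  exact: vu.
exact: vu.
Qed.

End ParameterPlane.

(** The quadratic form d |-> <Df_v d, Df_u d> is positive definite for v near u, so
    by the mean value theorem f cannot take the same value at two points near u. *)
Lemma locally_injective (R : realType) (f A B : 'rV[R]_2 -> 'rV[R]_3) (u : 'rV[R]_2) :
  (forall v a, is_derive v a f (a 0 0 *: A v + a 0 1 *: B v)) ->
  {for u, continuous A} -> {for u, continuous B} ->
  dotp (A u) (A u) = 1 -> dotp (A u) (B u) = 0 -> dotp (B u) (B u) = 1 ->
  exists2 e : R, 0 < e & forall v w : 'rV[R]_2,
    `|v 0 0 - u 0 0| < e -> `|v 0 1 - u 0 1| < e ->
    `|w 0 0 - u 0 0| < e -> `|w 0 1 - u 0 1| < e -> f v = f w -> v = w.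
Proof.
move=> df cA cB AA AB BB.
have definite (p y x d0 d1 : R) : 1/2 < p -> 1/2 < y -> `|x| < 1/2 ->
    d0 ^+ 2 * p + d0 * d1 * x + d1 ^+ 2 * y = 0 -> d0 = 0 /\ d1 = 0.
  move=> p1 y1; rewrite ltr_norml => /andP[x1 x2] E.
  have h1 : 0 <= (d0 + d1) ^+ 2 by exact: sqr_ge0.
  have h2 : 0 <= (d0 - d1) ^+ 2 by exact: sqr_ge0.
  have k1 : 0 <= (1/2 + x) * (d0 + d1) ^+ 2 by apply: mulr_ge0 => //; lra.
  have k2 : 0 <= (1/2 - x) * (d0 - d1) ^+ 2 by apply: mulr_ge0 => //; lra.
  have k3 : 0 <= (p - 1/2) * d0 ^+ 2 by apply: mulr_ge0; [lra | exact: sqr_ge0].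
  have k4 : 0 <= (y - 1/2) * d1 ^+ 2 by apply: mulr_ge0; [lra | exact: sqr_ge0].
  have s0 := sqr_ge0 d0; have s1 := sqr_ge0 d1.
  by split; apply/eqP; rewrite -sqrf_eq0; apply/eqP; lra.
have cdot (F : 'rV[R]_2 -> 'rV[R]_3) e : {for u, continuous F} ->
    {for u, continuous (fun v => dotp (F v) e)}.
  move=> cF; rewrite (_ : (fun v => _) = fun v =>
      F v 0 0 * e 0 0 + F v 0 1 * e 0 1 + F v 0 2 * e 0 2); last first.
    by apply/funext => v; rewrite dotpE.
  have cj j : {for u, continuous (fun v => F v 0 j * e 0 j)}.
    have h := continuous_comp cF (@coord_continuous _ _ _ 0 j (F u)).
    exact: (cvgM h (cvg_cst (e 0 j))).
  exact: (cvgD (cvgD (cj 0) (cj 1)) (cj 2)).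
have [e e0 he] : exists2 e : R, 0 < e & forall v : 'rV[R]_2,
    `|v 0 0 - u 0 0| < e -> `|v 0 1 - u 0 1| < e ->
    [/\ 1/2 < dotp (A v) (A u), 1/2 < dotp (B v) (B u) &
        `|dotp (A v) (B u) + dotp (B v) (A u)| < 1/2].
  apply/nbhs_row2P; near=> v; split; near: v.
  - by apply: (cvgr_gt _ (cdot _ _ cA)); rewrite AA; lra.
  - by apply: (cvgr_gt _ (cdot _ _ cB)); rewrite BB; lra.
  - have h : {for u, continuous (fun v => dotp (A v) (B u) + dotp (B v) (A u))}.
      exact: (cvgD (cdot _ (B u) cA) (cdot _ (A u) cB)).
    apply: (cvgr_norm_lt _ h).
    by rewrite (dotpC (B u)) AB addr0 normr0; lra.
exists e => // v w hv0 hv1 hw0 hw1 fvw.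
pose d := v - w.
(* On the segment from w to v, the component of f along Df_u (v - w) is increasing. *)
pose e' := d 0 0 *: A u + d 0 1 *: B u.
pose q (x : 'rV[R]_2) := dotp (d 0 0 *: A x + d 0 1 *: B x) e'.
pose Phi (r : R) := dotp (f (r *: d + w)) e'.
have dPhi (r : R) : is_derive r (1 : R) Phi (q (r *: d + w)).
  have h : is_derive r (1 : R) (fun r : R => f (r *: d + w))
     (d 0 0 *: A (r *: d + w) + d 0 1 *: B (r *: d + w)).
    apply/is_derive_rowP => j.
    have /is_derive_rowP/(_ j) := df (r *: d + w) d.
    move=> /is_derive_lineP h.
    apply/is_derive_lineP.
    rewrite (_ : (fun x : R => _) = fun h : R => f (h *: d + (r *: d + w)) 0 j) //.
    by  apply/funext => x; rewrite scalerDl addrA [_%:A]mulr1.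
  have := is_derive_dotp h (is_derive_cst e' r (1 : R)).
  move=> h'; apply: (is_derive_eq h').
  by rewrite [X in _ + X](_ : _ = 0) ?addr0 // dotpE !mxE; ring.
have [r r01] : exists2 r, r \in `]0, 1[ & Phi 1 - Phi 0 = q (r *: d + w) * (1 - 0).
  apply: MVT => //.
  apply: continuous_subspaceT => x; apply: differentiable_continuous.
  by apply/derivable1_diffP; have [] := dPhi x.
rewrite /Phi scale1r scale0r add0r subrK fvw subrr subr0 mulr1 => /esym qr.
have near01 (j : 'I_2) : `|v 0 j - u 0 j| < e -> `|w 0 j - u 0 j| < e ->
    `|(r *: d + w) 0 j - u 0 j| < e.
  move: r01; rewrite in_itv /= !mxE !ltr_norml => /andP[r0 r1] /andP[a1 a2] /andP[b1 b2].
  by apply/andP; split; nra.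
have [p1 p2 p3] := he _ (near01 0 hv0 hw0) (near01 1 hv1 hw1).
have : q (r *: d + w) = d 0 0 ^+ 2 * dotp (A (r *: d + w)) (A u) +
    d 0 0 * d 0 1 * (dotp (A (r *: d + w)) (B u) + dotp (B (r *: d + w)) (A u)) +
    d 0 1 ^+ 2 * dotp (B (r *: d + w)) (B u).
  by rewrite /q /e' !dotpE !mxE; ring.
rewrite qr => /esym/(definite _ _ _ _ _ p1 p2 p3)[z0 z1].
apply: row2P; apply/eqP; rewrite -subr_eq0; apply/eqP.
  by move: z0; rewrite !mxE.
by move: z1; rewrite !mxE.
Unshelve. all: by end_near. Qed.

(** * Smooth curves *)

Section SmoothCurves.
Variable R : realType.

Definition smooth (f : R -> R) := forall k, Ck k f.
Definition smooth_curve (f : R -> 'rV[R]_3) := forall j, smooth (fun s => f s 0 j).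

Lemma derive1_periodic (V : normedModType R) (f : R -> V) (T : R) :
  trigo.periodic f T -> trigo.periodic f^`() T.
Proof.
move=> pf s; rewrite !derive1E /derive.
set g1 := fun h => h^-1 *: _; set g2 := fun h => h^-1 *: _.
suff -> : g1 = g2 by [].
by rewrite funeqE /g1 /g2 => h /=; rewrite addrA !pf.
Qed.

Lemma smooth_curve_derive (f f' : R -> 'rV[R]_3) : smooth_curve f ->
  (forall s, is_derive s (1 : R) f (f' s)) -> smooth_curve f'.
Proof.
move=> Cf df j k.
suff -> : (fun s => f' s 0 j) = 'D_1 (fun s => f s 0 j).
  exact: Ck_derive (Cf j k.+1).
by apply/funext => s; have /is_derive_rowP/(_ j)[] := df s.
Qed.

Lemma smooth_curve_is_derive (f : R -> 'rV[R]_3) : smooth_curve f ->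
  forall s, is_derive s (1 : R) f (f^`() s).
Proof.
move=> Cf s.
have df : derivable f s 1.
  apply/derivable_mxP => i j; rewrite ord1.
  exact: (@Ck_derivable _ _ 0 _ s (1 : R) (Cf j 1%N)).
by apply: DeriveDef => //; rewrite derive1E.
Qed.

Lemma smooth_dotp (f g : R -> 'rV[R]_3) : smooth_curve f -> smooth_curve g ->
  smooth (fun s => dotp (f s) (g s)).
Proof.
move=> Cf Cg k.
rewrite (_ : (fun s => _) = fun s =>
  f s 0 0 * g s 0 0 + f s 0 1 * g s 0 1 + f s 0 2 * g s 0 2); last first.
  by apply/funext => s; rewrite dotpE.
by do ?apply: CkD; apply: CkM; do ?[exact: Cf | exact: Cg].
Qed.

Lemma smooth_crossp (f g : R -> 'rV[R]_3) : smooth_curve f -> smooth_curve g ->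
  smooth_curve (fun s => crossp (f s) (g s)).
Proof.
move=> Cf Cg j k.
rewrite (_ : (fun s => _) = fun s =>
  f s 0 (j + 1) * g s 0 (j + 2) - f s 0 (j + 2) * g s 0 (j + 1)); last first.
  by apply/funext => s; rewrite mxE.
by apply: CkB; apply: CkM; do ?[exact: Cf | exact: Cg].
Qed.

Lemma smooth_scale (a : R -> R) (f : R -> 'rV[R]_3) : smooth a -> smooth_curve f ->
  smooth_curve (fun s => a s *: f s).
Proof.
move=> Ca Cf j k; rewrite (_ : (fun s => _) = fun s => a s * f s 0 j).
  by apply: CkM; [exact: Ca | exact: Cf].
by apply/funext => s; rewrite mxE.
Qed.

Lemma smooth_curveD (f g : R -> 'rV[R]_3) : smooth_curve f -> smooth_curve g ->
  smooth_curve (fun s => f s + g s).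
Proof.
move=> Cf Cg j k; rewrite (_ : (fun s => _) = fun s => f s 0 j + g s 0 j).
  by apply: CkD; [exact: Cf | exact: Cg].
by apply/funext => s; rewrite mxE.
Qed.

Lemma smooth_is_derive (f : R -> R) : smooth f ->
  forall s, is_derive s (1 : R) f (f^`() s).
Proof. by move=> Cf s; rewrite derive1E; exact: (Ck_is_derive _ _ (Cf 1%N)). Qed.

Lemma smooth_derive1 (f : R -> R) : smooth f -> smooth f^`().
Proof.
move=> Cf k; rewrite (_ : f^`() = 'D_1 f); first exact: Ck_derive (Cf k.+1).
by apply/funext => s; rewrite derive1E.
Qed.

Lemma smooth_continuous (f : R -> R) : smooth f -> continuous f.
Proof. by move=> /(_ 0%N) []. Qed.

Lemma is_derive_scale (a : R -> R) (f : R -> 'rV[R]_3) (s da : R) (df : 'rV[R]_3) :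
  is_derive s (1 : R) a da -> is_derive s (1 : R) f df ->
  is_derive s (1 : R) (fun s => a s *: f s) (da *: f s + a s *: df).
Proof.
move=> ha /is_derive_rowP hf; apply/is_derive_rowP => j.
rewrite (_ : (fun s => _) = fun s => a s * f s 0 j); last first.
  by apply/funext => x; rewrite mxE.
by apply: (is_derive_eq (is_deriveM' ha (hf j))); rewrite !mxE.
Qed.

End SmoothCurves.

(** * Parallel normal fields along a Frenet curve *)

Section BishopFrames.
Variable R : realType.
Variables (L : R) (c : R -> 'rV[R]_3).
Local Notation periodic f := (trigo.periodic f L).

(** A periodic frame (c', W, N) whose normal fields have purely tangential
    derivatives; kg and kn are the geodesic and normal curvatures of c in any surface
    with normal N along c. *)
Record bishop_frame (W N : R -> 'rV[R]_3) (kg kn : R -> R) : Prop := {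
  bf_smooth : [/\ smooth_curve c, smooth_curve (c^`()), smooth_curve W & smooth_curve N];
  bf_smooth_curv : smooth kg /\ smooth kn;
  bf_periodic : [/\ periodic c, periodic (c^`()), periodic W & periodic N];
  bf_periodic_curv : periodic kg /\ periodic kn;
  bf_oframe : forall s, oframe (c^`() s) (W s) (N s);
  bf_dc : forall s, is_derive s (1 : R) c (c^`() s);
  bf_dt : forall s, is_derive s (1 : R) c^`() (kg s *: W s + kn s *: N s);
  bf_dW : forall s, is_derive s (1 : R) W (- kg s *: c^`() s);
  bf_dN : forall s, is_derive s (1 : R) N (- kn s *: c^`() s)
}.

Hypothesis hc : closed_Frenet_curve L c.
Local Notation t := (c^`()).
Local Notation k := (curvature c).
Local Notation n := (principal_normal c).
Local Notation b := (binormal c).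
Local Notation tau := (torsion c).

Lemma frenet_smooth_c : smooth_curve c.
Proof. by move=> j m; apply: Ck_curve => i s; apply: (frenet_smooth hc). Qed.

Lemma frenet_smooth_t : smooth_curve t.
Proof.
apply: smooth_curve_derive frenet_smooth_c _.
exact: smooth_curve_is_derive frenet_smooth_c.
Qed.

Lemma frenet_smooth_t' : smooth_curve t^`().
Proof.
apply: smooth_curve_derive frenet_smooth_t _.
exact: smooth_curve_is_derive frenet_smooth_t.
Qed.

Lemma frenet_dotp_t't' s : 0 < dotp (t^`() s) (t^`() s).
Proof. by have := frenet_curvature_gt0 hc s; rewrite /curvature /enorm sqrtr_gt0. Qed.

Lemma frenet_smooth_k : smooth k.
Proof.
move=> m; apply: Ck_sqrt; first exact: frenet_dotp_t't'.
exact: smooth_dotp frenet_smooth_t' frenet_smooth_t' m.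
Qed.

Lemma frenet_k_neq0 s : k s != 0.
Proof. by rewrite gt_eqF // (frenet_curvature_gt0 hc). Qed.

Lemma frenet_smooth_n : smooth_curve n.
Proof.
apply: smooth_scale frenet_smooth_t' => m; apply: CkV; first exact: frenet_k_neq0.
exact: frenet_smooth_k.
Qed.

Lemma frenet_smooth_b : smooth_curve b.
Proof. exact: smooth_crossp frenet_smooth_t frenet_smooth_n. Qed.

Lemma frenet_t' s : t^`() s = k s *: n s.
Proof. by rewrite /principal_normal scalerA divff ?scale1r // frenet_k_neq0. Qed.

Lemma frenet_oframe s : oframe (t s) (n s) (b s).
Proof.
have tt x : dotp (t x) (t x) = 1.
  have := frenet_arc_length hc x; rewrite /enorm => h.
  by rewrite -[LHS]sqr_sqrtr ?dotp_ge0 // h expr1n.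
have kk : k s * k s = dotp (t^`() s) (t^`() s).
  by rewrite -expr2 sqr_sqrtr // dotp_ge0.
split=> //.
- by rewrite dotpZl dotpZr -kk; field; exact: frenet_k_neq0.
- have dt := smooth_curve_is_derive frenet_smooth_t s.
  have := is_derive_dotp dt dt.
  rewrite (_ : (fun y => _) = fun=> 1); last by apply/funext => x; rewrite tt.
  case=> _; rewrite derive_cst dotpC => h.
  by rewrite dotpZr (_ : dotp (t s) (t^`() s) = 0) ?mulr0 //; lra.
Qed.

(** [torsion] only records the n-component of b'; the other components of n' and
    b' come from differentiating the orthonormality relations. *)
Lemma frenet_equations s :
  is_derive s (1 : R) n (- k s *: t s + tau s *: b s) /\
  is_derive s (1 : R) b (- tau s *: n s).
Proof.
have half0 (x : R) : x + x = 0 -> x = 0 by lra.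
have opp0 (x y : R) : x + y = 0 -> y = - x by lra.
have dn := smooth_curve_is_derive frenet_smooth_n s.
have db := smooth_curve_is_derive frenet_smooth_b s.
have dt := smooth_curve_is_derive frenet_smooth_t s.
have orth x := oframe_dotp (frenet_oframe x).
have cst0 (f g : R -> 'rV[R]_3) (a : R) df dg : (forall x, dotp (f x) (g x) = a) ->
    is_derive s (1 : R) f df -> is_derive s (1 : R) g dg ->
    dotp df (g s) + dotp (f s) dg = 0.
  move=> fg hf hg; have := is_derive_dotp hf hg.
  rewrite (_ : (fun y => _) = fun=> a); last by apply/funext => x; rewrite fg.
  by case=> _; rewrite derive_cst.
have [[tt nn bb] [tn tb nb]] := orth s.
have hnn := cst0 _ _ 1 _ _ (fun x => let: conj (And3 _ h _) _ := orth x in h) dn dn.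
have hbb := cst0 _ _ 1 _ _ (fun x => let: conj (And3 _ _ h) _ := orth x in h) db db.
have htn := cst0 _ _ 0 _ _ (fun x => let: conj _ (And3 h _ _) := orth x in h) dt dn.
have htb := cst0 _ _ 0 _ _ (fun x => let: conj _ (And3 _ h _) := orth x in h) dt db.
have hnb := cst0 _ _ 0 _ _ (fun x => let: conj _ (And3 _ _ h) := orth x in h) dn db.
have etau : tau s = - dotp (b^`() s) (n s) by [].
rewrite frenet_t' (dotpZl (k s) (n s)) nn in htn.
rewrite frenet_t' (dotpZl (k s) (n s)) nb in htb.
rewrite ![dotp (n s) (n^`() s)]dotpC in hnn; rewrite [dotp (b s) _]dotpC in hbb.
rewrite [dotp (t s) _]dotpC in htn; rewrite [dotp (t s) _]dotpC in htb.
rewrite [dotp (n s) _]dotpC in hnb.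
split.
- apply: (is_derive_eq dn); rewrite [LHS](comb_dotp (frenet_oframe s)) /comb.
  rewrite (half0 _ hnn) (opp0 _ _ htn) mulr1.
  have -> : dotp (n^`() s) (b s) = tau s by rewrite etau; apply: opp0; rewrite addrC.
  by rewrite scale0r addr0.
- apply: (is_derive_eq db); rewrite [LHS](comb_dotp (frenet_oframe s)) /comb.
  rewrite (half0 _ hbb) (opp0 _ _ htb) mulr0 oppr0.
  have -> : dotp (b^`() s) (n s) = - tau s by rewrite etau opprK.
  by rewrite !scale0r addr0 add0r.
Qed.

Lemma frenet_smooth_tau : smooth tau.
Proof.
move=> m; apply: CkN; apply: smooth_dotp frenet_smooth_n m.
apply: smooth_curve_derive frenet_smooth_b _.
exact: smooth_curve_is_derive frenet_smooth_b.
Qed.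

Lemma frenet_periodic_all :
  [/\ periodic t, periodic k, periodic n, periodic b & periodic tau].
Proof.
have pt : periodic t by apply: derive1_periodic; exact: frenet_periodic hc.
have pt' := derive1_periodic pt.
have pk : periodic k by move=> s; rewrite /curvature /tangent pt'.
have pn : periodic n by move=> s; rewrite /principal_normal /tangent pt' pk.
have pb : periodic b by move=> s; rewrite /binormal /tangent pt pn.
split; [exact: pt|exact: pk|exact: pn|exact: pb|].
move=> s; rewrite /torsion (pn s).
exact: (@congr1 'rV[R]_3 R (fun u => - dotp u (n s)) _ _ (derive1_periodic pb s)).
Qed.

(** Rotating the pair (n, b) by the angle a0 - \int tau makes both fields parallel
    in the normal bundle, and the hypothesis on the total torsion makes the
    rotated frame close up. The derivatives of kn at s1 for a0 = 0 and a0 = pi / 2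
    are the components, in a rotated basis, of a vector of norm at least
    |k (s1) tau (s1)|, so they do not both vanish. *)
Lemma exists_bishop_frame :
  (exists m : int, \int[lebesgue_measure]_(s in `[0, L]) tau s = 2 * m%:~R * pi) ->
  (exists2 s, s \in `[0, L] & tau s != 0) ->
  exists W N kg kn, bishop_frame W N kg kn /\
    exists2 s, s \in `[0, L] & kn^`() s != 0.
Proof.
move=> [m hm] [s1 s1L tau1].
have [pt pk pn pb ptau] := frenet_periodic_all.
have [T dT] := exists_primitive (smooth_continuous frenet_smooth_tau).
have CT : smooth T.
  by case=> [|i]; [apply: CkW|]; apply: Ck1 dT _; apply: frenet_smooth_tau.
have TL s : T (s + L) = T s + 2 * m%:~R * pi.
  have := Rintegral_primitive (frenet_length_gt0 hc)
    (smooth_continuous frenet_smooth_tau) dT.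
  rewrite hm => ->.
  by have := primitive_increment ptau dT s 0; rewrite add0r; lra.
have trig (a0 s : R) : cos (a0 - T (s + L)) = cos (a0 - T s) /\
                     sin (a0 - T (s + L)) = sin (a0 - T s).
  have e (i : nat) (x : R) : x - 2 * i%:R * pi + pi *+ 2 *+ i = x.
    by rewrite -[pi *+ 2]mulr_natl -mulr_natl; ring.
  have per (f : R -> R) : trigo.periodic f (pi *+ 2) ->
      forall x, f (x - 2 * m%:~R * pi) = f x.
    move=> pf x; case: m {hm TL} => i.
      by rewrite -[in RHS](e i x) (periodicn pf).
    rewrite NegzE rmorphN /= mulrN mulNr opprK -(periodicn pf i.+1 x); congr f.
    by rewrite -[pi *+ 2]mulr_natl -mulr_natl; ring.
  by rewrite TL opprD addrA !per; [|exact: sinD2pi|exact: cosD2pi].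
pose th (a0 s : R) := a0 - T s.
have dth (a0 s : R) : is_derive s (1 : R) (th a0) (- tau s).
  by apply: (is_derive_eq (is_deriveB (is_derive_cst a0 s 1) (dT s))); rewrite sub0r.
have Cth a0 : smooth (th a0) by move=> i; apply: CkB; [exact: Ck_cst | exact: CT].
have dsin (a0 s : R) :
    is_derive s (1 : R) (fun s => sin (th a0 s)) (- cos (th a0 s) * tau s).
  have h := is_derive_chain (is_derive_sin (th a0 s)) (dth a0 s).
  by apply: (is_derive_eq h); rewrite mulrN mulNr.
have dcos (a0 s : R) :
    is_derive s (1 : R) (fun s => cos (th a0 s)) (sin (th a0 s) * tau s).
  have h := is_derive_chain (is_derive_cos (th a0 s)) (dth a0 s).
  by apply: (is_derive_eq h); rewrite mulrN mulNr opprK.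
have Csin a0 : smooth (fun s => sin (th a0 s)).
  by move=> i; have [] := Ck_sin_cos (Cth a0 i).
have Ccos a0 : smooth (fun s => cos (th a0 s)).
  by move=> i; have [] := Ck_sin_cos (Cth a0 i).
have dk := smooth_is_derive frenet_smooth_k.
have dkn (a0 s : R) : is_derive s (1 : R) (fun s => - k s * sin (th a0 s))
    (- k^`() s * sin (th a0 s) + k s * cos (th a0 s) * tau s).
  apply: (is_derive_eq (is_deriveM' (is_deriveN (dk s)) (dsin a0 s))).
  by rewrite mulNr mulrA mulrNN.
have alg (S C k0 t0 k1 : R) : k0 != 0 -> C ^+ 2 + S ^+ 2 = 1 ->
    - k1 * - S + k0 * C * t0 = 0 -> - k1 * C + k0 * S * t0 = 0 -> t0 = 0.
  move=> k00 cs e1 e2; apply: (mulfI k00); rewrite mulr0.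
  have -> : k0 * t0 = k0 * t0 * (C ^+ 2 + S ^+ 2) by rewrite cs mulr1.
  have -> : k0 * t0 * (C ^+ 2 + S ^+ 2) =
    C * (- k1 * - S + k0 * C * t0) + S * (- k1 * C + k0 * S * t0) by ring.
  by rewrite e1 e2 !mulr0 addr0.
have [a0 kap'0] : exists a0 : R,
    - k^`() s1 * sin (th a0 s1) + k s1 * cos (th a0 s1) * tau s1 != 0.
  have [h|h] := eqVneq (- k^`() s1 * sin (th 0 s1) + k s1 * cos (th 0 s1) * tau s1) 0;
    last by exists 0.
  exists (pi / 2); apply: contraNneq tau1 => h'; apply/eqP.
  apply: alg (frenet_k_neq0 s1) (cos2Dsin2 (T s1)) _ _.
    by rewrite -[RHS]h /th sub0r sinN cosN.
  by rewrite -[RHS]h' /th -[pi / 2 - _]opprB sinN cosN sinBpihalf cosBpihalf opprK.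
have Cn := frenet_smooth_n; have Cb := frenet_smooth_b.
exists (fun s => cos (th a0 s) *: n s + sin (th a0 s) *: b s).
exists (fun s => - sin (th a0 s) *: n s + cos (th a0 s) *: b s).
exists (fun s => k s * cos (th a0 s)), (fun s => - k s * sin (th a0 s)).
split; last by exists s1 => //; rewrite derive1E; have [_ ->] := dkn a0 s1.
split.
- split.
  + exact: frenet_smooth_c.
  + exact: frenet_smooth_t.
  + by apply: smooth_curveD; apply: smooth_scale.
  + apply: smooth_curveD; apply: smooth_scale => // i.
    by apply: CkN; exact: Csin.
- split=> i; apply: CkM; [exact: frenet_smooth_k|exact: Ccos| |exact: Csin].
  by apply: CkN; exact: frenet_smooth_k.
- have pc := frenet_periodic hc.
  split; [exact: pc|exact: pt| |] => s;
    by have [-> ->] := trig a0 s; rewrite (pn s) (pb s).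
- split=> s; have [hC hS] := trig a0 s; rewrite /th.
    by rewrite hC (pk s).
  by rewrite hS (pk s).
- move=> s.
  have fr := frenet_oframe s.
  have cs := cos2Dsin2 (th a0 s).
  have E (x y : R) : x *: n s + y *: b s = comb (t s) (n s) (b s) 0 x y.
    by rewrite /comb scale0r add0r.
  have Et : t s = comb (t s) (n s) (b s) 1 0 0 by rewrite /comb scale1r !scale0r !addr0.
  rewrite !E {1}Et; split.
  + by rewrite dotp_comb //; ring.
  + by rewrite dotp_comb // -cs; ring.
  + by rewrite dotp_comb //; ring.
  + by rewrite crossp_comb //; congr comb; ring.
- exact: smooth_curve_is_derive frenet_smooth_c.
- move=> s; apply: (is_derive_eq (smooth_curve_is_derive frenet_smooth_t s)).
  rewrite frenet_t'; have cs := cos2Dsin2 (th a0 s).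
  move: (n s) (b s) (k s) (cos _) (sin _) cs => n0 b0 k0 C S cs.
  apply/rowP => j; rewrite !mxE -[LHS]mulr1 -cs; ring.
- move=> s; have [dn db] := frenet_equations s.
  have h := is_deriveD (is_derive_scale (dcos a0 s) dn) (is_derive_scale (dsin a0 s) db).
  apply: (is_derive_eq h).
  move: (t s) (n s) (b s) (tau s) (k s) (cos _) (sin _) => t0 n0 b0 tau0 k0 C S.
  by apply/rowP => j; rewrite !mxE; ring.
- move=> s; have [dn db] := frenet_equations s.
  have dns : is_derive s (1 : R) (fun s => - sin (th a0 s)) (cos (th a0 s) * tau s).
    by apply: (is_derive_eq (is_deriveN (dsin a0 s))); rewrite mulNr opprK.
  have h := is_deriveD (is_derive_scale dns dn) (is_derive_scale (dcos a0 s) db).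
  apply: (is_derive_eq h).
  move: (t s) (n s) (b s) (tau s) (k s) (cos _) (sin _) => t0 n0 b0 tau0 k0 C S.
  by apply/rowP => j; rewrite !mxE; ring.
Qed.

End BishopFrames.

(** * The canal surface *)

Section CanalSurface.
Variable R : realType.
Variables (L : R) (c W N : R -> 'rV[R]_3) (kg kn : R -> R).
Hypothesis bf : bishop_frame L c W N kg kn.
Local Notation t := (c^`()).

(** The difference of the two principal curvatures along c. Since 1 / curv_gap
    is exp (kn'), the integral of kn' / curv_gap over a period is not zero. *)
Definition curv_gap s := expR (- kn^`() s).
(** 2 beta is the principal curvature along the circles. *)
Definition beta s := (kn s - curv_gap s) / 2.
(** Minus beta' / curv_gap, in explicit form. *)
Definition gamma s := - (kn^`()^`() s + kn^`() s * expR (kn^`() s)) / 2.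

Lemma smooth_kn' : smooth kn^`(). Proof. exact: smooth_derive1 (bf_smooth_curv bf).2. Qed.

Lemma smooth_curv_gap : smooth curv_gap.
Proof. by move=> k; apply: Ck_expR; apply: CkN; exact: smooth_kn'. Qed.

Lemma smooth_beta : smooth beta.
Proof.
move=> k; apply: CkM; last exact: Ck_cst.
by apply: CkB; [exact: (bf_smooth_curv bf).2 | exact: smooth_curv_gap].
Qed.

Lemma smooth_gamma : smooth gamma.
Proof.
move=> k; apply: CkM; last exact: Ck_cst.
apply: CkN; apply: CkD; first exact: smooth_derive1 smooth_kn' k.
by apply: CkM; [|apply: Ck_expR]; exact: smooth_kn'.
Qed.

Lemma curv_gap_gt0 s : 0 < curv_gap s. Proof. exact: expR_gt0. Qed.

Lemma curv_gapE s : curv_gap s = kn s - 2 * beta s.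
Proof. by rewrite /beta; field. Qed.

(** This relation makes the plane of the circle at s orthogonal to the derivative
    of the centre c + N / (2 beta) of the touching sphere, that is, makes the
    surface the envelope of these spheres. *)
Lemma is_derive_beta s : is_derive s (1 : R) beta (- curv_gap s * gamma s).
Proof.
have dkn := smooth_is_derive (bf_smooth_curv bf).2 s.
have dkn' := smooth_is_derive smooth_kn' s.
have dg := @is_derive_chain _ _ expR (fun s => - kn^`() s) s 1 _ _
  (is_derive_expR _) (is_deriveN' dkn').
have h := is_deriveM' (is_deriveB' dkn dg) (is_derive_cst' (2^-1) s (1 : R)).
apply: (is_derive_eq h); rewrite /curv_gap /gamma expRN.
by field; rewrite gt_eqF // expR_gt0.
Qed.

Implicit Types (u a : 'rV[R]_2).
Local Notation Sof u := (u 0 0).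
Local Notation Lof u := (u 0 1).

(** 1 + l^2 |K|^2. *)
Definition den u := 1 + Lof u ^+ 2 * (beta (Sof u) ^+ 2 + gamma (Sof u) ^+ 2).

Lemma den_gt0 u : 0 < den u.
Proof. by rewrite /den ltr_pwDl // mulr_ge0 ?addr_ge0 ?sqr_ge0. Qed.

Definition in_frame u x y z := comb (t (Sof u)) (W (Sof u)) (N (Sof u)) x y z.

Definition surf u := c (Sof u) +
  in_frame u (Lof u ^+ 2 * gamma (Sof u) / den u) (Lof u / den u)
             (Lof u ^+ 2 * beta (Sof u) / den u).

(** E1 = t - 2 gamma X, E2 = ((1 - l^2 |K|^2) W + 2 l K) / (1 + l^2 |K|^2) and
    E3 = N - 2 beta X, where X = surf - c. *)
Definition E1 u := in_frame u
  (1 - 2 * gamma (Sof u) * (Lof u ^+ 2 * gamma (Sof u) / den u))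
  (- (2 * gamma (Sof u) * (Lof u / den u)))
  (- (2 * gamma (Sof u) * (Lof u ^+ 2 * beta (Sof u) / den u))).
Definition E2 u := in_frame u
  (2 * Lof u * gamma (Sof u) / den u)
  ((1 - Lof u ^+ 2 * (beta (Sof u) ^+ 2 + gamma (Sof u) ^+ 2)) / den u)
  (2 * Lof u * beta (Sof u) / den u).
Definition E3 u := in_frame u
  (- (2 * beta (Sof u) * (Lof u ^+ 2 * gamma (Sof u) / den u)))
  (- (2 * beta (Sof u) * (Lof u / den u)))
  (1 - 2 * beta (Sof u) * (Lof u ^+ 2 * beta (Sof u) / den u)).

Definition in_E u x y z := comb (E1 u) (E2 u) (E3 u) x y z.

(** The components on E1 and E2 of the s-derivative of [surf]. *)
Definition speed u :=
  (1 - kg (Sof u) * Lof u +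
   (beta (Sof u) ^+ 2 - gamma (Sof u) ^+ 2 + gamma^`() (Sof u)
    - beta (Sof u) * kn (Sof u)) * Lof u ^+ 2)
  / den u.
Definition shear u := gamma (Sof u) * (2 * Lof u - kg (Sof u) * Lof u ^+ 2) / den u.

Lemma E_oframe u : oframe (E1 u) (E2 u) (E3 u).
Proof.
have fr := bf_oframe bf (Sof u); have := lt0r_neq0 (den_gt0 u).
rewrite /E1 /E2 /E3 /in_frame /den.
move: (t _) (W _) (N _) (beta _) (gamma _) (Lof u) fr => e1 e2 e3 b g l fr q0.
split; rewrite ?dotp_comb ?crossp_comb //.
- by field.
- by field.
- by field.
- by congr comb; field.
Qed.

Lemma comb_comb (e1 e2 e3 : 'rV[R]_3) x1 y1 z1 x2 y2 z2 x3 y3 z3 x y z :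
  comb (comb e1 e2 e3 x1 y1 z1) (comb e1 e2 e3 x2 y2 z2) (comb e1 e2 e3 x3 y3 z3) x y z =
  comb e1 e2 e3 (x * x1 + y * x2 + z * x3) (x * y1 + y * y2 + z * y3)
              (x * z1 + y * z2 + z * z3).
Proof. by apply/rowP => j; rewrite !combE; ring. Qed.

Lemma combD (e1 e2 e3 : 'rV[R]_3) x y z x' y' z' :
  comb e1 e2 e3 x y z + comb e1 e2 e3 x' y' z' = comb e1 e2 e3 (x + x') (y + y') (z + z').
Proof. by apply/rowP => j; rewrite mxE !combE; ring. Qed.

(** The derivatives are taken along an arbitrary map U into the parameter plane,
    in order to cover both the partial derivatives of the surface and the velocity of curves
    drawn on it. *)
Section MovingPoint.
Variables (V : normedModType R) (U : V -> 'rV[R]_2) (x v : V) (a : 'rV[R]_2).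
Hypothesis hU : is_derive x v U a.

Lemma is_derive_Lof : is_derive x v (fun y => Lof (U y)) (Lof a).
Proof. by have /is_derive_rowP := hU; apply. Qed.

Lemma is_derive_Sof (f : R -> R) f' : is_derive (Sof (U x)) (1 : R) f f' ->
  is_derive x v (fun y => f (Sof (U y))) (f' * Sof a).
Proof.
by move=> df; apply: is_derive_chain => //; have /is_derive_rowP := hU; apply.
Qed.

Lemma is_derive_Sof_curve (f : R -> 'rV[R]_3) f' : is_derive (Sof (U x)) (1 : R) f f' ->
  is_derive x v (fun y => f (Sof (U y))) (Sof a *: f').
Proof.
move=> /is_derive_rowP df; apply/is_derive_rowP => j.
by apply: (is_derive_eq (is_derive_Sof (df j))); rewrite mxE mulrC.
Qed.

Lemma is_derive_in_frame (X Y Z : V -> R) dX dY dZ :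
  is_derive x v X dX -> is_derive x v Y dY -> is_derive x v Z dZ ->
  is_derive x v (fun y => in_frame (U y) (X y) (Y y) (Z y))
    (in_frame (U x) (dX - Sof a * (kg (Sof (U x)) * Y x + kn (Sof (U x)) * Z x))
       (dY + Sof a * kg (Sof (U x)) * X x) (dZ + Sof a * kn (Sof (U x)) * X x)).
Proof.
move=> hX hY hZ; apply/is_derive_rowP => j.
have /is_derive_rowP/(_ j) ht := is_derive_Sof_curve (bf_dt bf (Sof (U x))).
have /is_derive_rowP/(_ j) hW := is_derive_Sof_curve (bf_dW bf (Sof (U x))).
have /is_derive_rowP/(_ j) hN := is_derive_Sof_curve (bf_dN bf (Sof (U x))).
have h := is_deriveD' (is_deriveD' (is_deriveM' hX ht) (is_deriveM' hY hW))
  (is_deriveM' hZ hN).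
rewrite (_ : (fun y => _) = fun y =>
    X y * t (Sof (U y)) 0 j + Y y * W (Sof (U y)) 0 j + Z y * N (Sof (U y)) 0 j).
  apply: (is_derive_eq h); rewrite combE !mxE; ring.
by apply/funext => y; rewrite /in_frame combE.
Qed.

Lemma is_derive_den : is_derive x v (fun y => den (U y))
  (2 * Lof (U x) * Lof a * (beta (Sof (U x)) ^+ 2 + gamma (Sof (U x)) ^+ 2) +
   Lof (U x) ^+ 2 * (2 * gamma (Sof (U x)) * Sof a *
     (gamma^`() (Sof (U x)) - beta (Sof (U x)) * curv_gap (Sof (U x))))).
Proof.
have hb := is_derive_Sof (is_derive_beta (Sof (U x))).
have hg := is_derive_Sof (smooth_is_derive smooth_gamma (Sof (U x))).
have hl := is_derive_Lof.
have h := is_deriveD' (is_derive_cst' (1 : R) x v)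
   (is_deriveM' (is_deriveM' hl hl) (is_deriveD' (is_deriveM' hb hb) (is_deriveM' hg hg))).
by apply: (is_derive_eq h); ring.
Qed.

(** The E3-component vanishes because of the relation between beta' and gamma. *)
Lemma is_derive_surf_comp :
  is_derive x v (fun y => surf (U y))
    (in_E (U x) (Sof a * speed (U x)) (Sof a * shear (U x) + Lof a / den (U x)) 0).
Proof.
have hb := is_derive_Sof (is_derive_beta (Sof (U x))).
have hg := is_derive_Sof (smooth_is_derive smooth_gamma (Sof (U x))).
have hl := is_derive_Lof.
have hq := @is_deriveV' _ _ (fun y => den (U y)) x v _
  (lt0r_neq0 (den_gt0 (U x))) is_derive_den.
have hx := is_deriveM' (is_deriveM' (is_deriveM' hl hl) hg) hq.
have hy := is_deriveM' hl hq.
have hz := is_deriveM' (is_deriveM' (is_deriveM' hl hl) hb) hq.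
have h := is_deriveD (is_derive_Sof_curve (bf_dc bf (Sof (U x))))
  (is_derive_in_frame hx hy hz).
apply: (is_derive_eq h).
have -> : Sof a *: t (Sof (U x)) = in_frame (U x) (Sof a) 0 0.
  by rewrite /in_frame /comb !scale0r !addr0.
rewrite /in_E /E1 /E2 /E3 /in_frame comb_comb /speed /shear curv_gapE.
rewrite combD; have := lt0r_neq0 (den_gt0 (U x)); rewrite /den.
move: (beta _) (gamma _) (kg _) (kn _) (gamma^`() _) (Lof (U x)) (Sof a) (Lof a).
move=> b g k1 k2 g' l a0 a1 q0.
by congr comb; field.
Qed.

Lemma is_derive_E3_comp :
  is_derive x v (fun y => E3 (U y))
    (in_E (U x)
     (- (Sof a * curv_gap (Sof (U x))) - 2 * beta (Sof (U x)) * (Sof a * speed (U x)))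
     (- (2 * beta (Sof (U x)) * (Sof a * shear (U x) + Lof a / den (U x)))) 0).
Proof.
have hb := is_derive_Sof (is_derive_beta (Sof (U x))).
have hg := is_derive_Sof (smooth_is_derive smooth_gamma (Sof (U x))).
have hl := is_derive_Lof.
have hq := @is_deriveV' _ _ (fun y => den (U y)) x v _
  (lt0r_neq0 (den_gt0 (U x))) is_derive_den.
have h2 := is_derive_cst' (2 : R) x v.
have h1 := is_derive_cst' (1 : R) x v.
have hx := is_deriveN' (is_deriveM' (is_deriveM' h2 hb)
  (is_deriveM' (is_deriveM' (is_deriveM' hl hl) hg) hq)).
have hy := is_deriveN' (is_deriveM' (is_deriveM' h2 hb) (is_deriveM' hl hq)).
have hz := is_deriveB' h1 (is_deriveM' (is_deriveM' h2 hb)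
  (is_deriveM' (is_deriveM' (is_deriveM' hl hl) hb) hq)).
have h := is_derive_in_frame hx hy hz.
apply: (is_derive_eq h).
rewrite /in_E /E1 /E2 /E3 /in_frame comb_comb /speed /shear curv_gapE.
have := lt0r_neq0 (den_gt0 (U x)); rewrite /den.
move: (beta _) (gamma _) (kg _) (kn _) (gamma^`() _) (Lof (U x)) (Sof a) (Lof a).
move=> b g k1 k2 g' l a0 a1 q0.
by congr comb; field.
Qed.

End MovingPoint.

Lemma is_derive_surf u a :
  is_derive u a surf (in_E u (Sof a * speed u) (Sof a * shear u + Lof a / den u) 0).
Proof. exact: is_derive_surf_comp (is_derive_id u a). Qed.

(** Rodrigues' formula: this is - 2 beta D_a surf - (Sof a * curv_gap) E1. *)
Lemma is_derive_E3 u a :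
  is_derive u a E3
    (in_E u (- (Sof a * curv_gap (Sof u)) - 2 * beta (Sof u) * (Sof a * speed u))
     (- (2 * beta (Sof u) * (Sof a * shear u + Lof a / den u))) 0).
Proof. exact: is_derive_E3_comp (is_derive_id u a). Qed.

Lemma surf_Ck k j : Ck k (fun u => surf u 0 j).
Proof.
have [Cc Ct CW CN] := bf_smooth bf.
have CL : Ck k (fun u : 'rV[R]_2 => Lof u) by exact: Ck_coord.
have pull f : smooth f -> Ck k (fun u : 'rV[R]_2 => f (Sof u)).
  by move=> Cf; apply: Ck_comp; [exact: Cf | exact: Ck_coord].
have Cb := pull _ smooth_beta; have Cg := pull _ smooth_gamma.
have CQ : Ck k (fun u => (den u)^-1).
  apply: CkV => [u|]; first by rewrite gt_eqF // den_gt0.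
  apply: CkD; first exact: Ck_cst.
  by apply: CkM; [exact: CkX | apply: CkD; exact: CkX].
rewrite (_ : (fun u => _) = fun u => c (Sof u) 0 j +
  (Lof u ^+ 2 * gamma (Sof u) / den u * t (Sof u) 0 j + Lof u / den u * W (Sof u) 0 j +
   Lof u ^+ 2 * beta (Sof u) / den u * N (Sof u) 0 j)); last first.
  by apply/funext => u; rewrite /surf /in_frame mxE combE.
apply: CkD; first exact: pull (Cc j).
apply: CkD; last first.
  by apply: CkM (pull _ (CN j)); apply: CkM CQ; apply: CkM Cb; exact: CkX.
apply: CkD; last by apply: CkM (pull _ (CW j)); exact: CkM CQ.
by apply: CkM (pull _ (Ct j)); apply: CkM CQ; apply: CkM Cg; exact: CkX.
Qed.

Lemma surf_continuous : continuous surf.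
Proof. by move=> u; apply: continuous_rowP => j; apply: (Ck_continuous (surf_Ck 0 j)). Qed.

Lemma derive_surf u a :
  'D_a surf u = in_E u (Sof a * speed u) (Sof a * shear u + Lof a / den u) 0.
Proof. by have [_ ->] := is_derive_surf u a. Qed.

Lemma den_pt0 s : den (pt s 0) = 1.
Proof. by rewrite /den pt1 expr0n mul0r addr0. Qed.

Lemma surf_pt0 s : surf (pt s 0) = c s.
Proof.
by rewrite /surf /in_frame pt0 pt1 !(expr0n, mul0r) /comb !scale0r !addr0.
Qed.

Lemma speed_pt0 s : speed (pt s 0) = 1.
Proof. by rewrite /speed den_pt0 pt1 !(expr0n, mulr0) subr0 addr0 divr1. Qed.

Lemma shear_pt0 s : shear (pt s 0) = 0.
Proof. by rewrite /shear pt1 !(expr0n, mulr0) subr0 mulr0 mul0r. Qed.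

Definition same_point u u' :=
  Lof u' = Lof u /\ exists m : int, Sof u' = Sof u + m%:~R * L.

Lemma periodicz (T : zmodType) (f : R -> T) : trigo.periodic f L ->
  forall s (m : int), f (s + m%:~R * L) = f s.
Proof.
move=> pf s [] i.
  by rewrite -(periodicn pf i s) mulr_natl.
rewrite NegzE rmorphN /= -[in RHS](subrK (i.+1%:R * L) s) [in RHS]mulr_natl.
by rewrite (periodicn pf) mulNr mulr_natl.
Qed.

Lemma periodic_beta_gamma :
  [/\ trigo.periodic beta L, trigo.periodic gamma L & trigo.periodic curv_gap L].
Proof.
have [pg pn] := bf_periodic_curv bf.
have pn1 := derive1_periodic pn; have pn2 := derive1_periodic pn1.
have pgap : trigo.periodic curv_gap L by move=> s; rewrite /curv_gap pn1.
split; last exact: pgap.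
- by move=> s; rewrite /beta pgap pn.
- by move=> s; rewrite /gamma pn1 pn2.
Qed.

Lemma same_point_eq u u' : same_point u u' ->
  [/\ surf u' = surf u, E1 u' = E1 u, E2 u' = E2 u & E3 u' = E3 u] /\
  [/\ speed u' = speed u, beta (Sof u') = beta (Sof u)
    & curv_gap (Sof u') = curv_gap (Sof u)].
Proof.
move=> [eL [m eS]].
have [pb pg pgap] := periodic_beta_gamma; have [pkg pkn] := bf_periodic_curv bf.
have [pc pt pW pN] := bf_periodic bf; have pg' := derive1_periodic pg.
have [eb eg egap] : [/\ beta (Sof u') = beta (Sof u), gamma (Sof u') = gamma (Sof u) &
    curv_gap (Sof u') = curv_gap (Sof u)].
  rewrite eS; split; first exact: periodicz pb _ _.
    exact: periodicz pg _ _.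
  exact: periodicz pgap _ _.
have [ekg ekn eg'] : [/\ kg (Sof u') = kg (Sof u), kn (Sof u') = kn (Sof u) &
    gamma^`() (Sof u') = gamma^`() (Sof u)].
  rewrite eS; split; first exact: periodicz pkg _ _.
    exact: periodicz pkn _ _.
  exact: periodicz pg' _ _.
have [ec et] : c (Sof u') = c (Sof u) /\ t (Sof u') = t (Sof u).
  by rewrite eS; split; [exact: periodicz pc _ _|exact: periodicz pt _ _].
have [eW eN] : W (Sof u') = W (Sof u) /\ N (Sof u') = N (Sof u).
  by rewrite eS; split; [exact: periodicz pW _ _|exact: periodicz pN _ _].
have eQ : den u' = den u by rewrite /den eL eb eg.
split; split; [| | | | |exact: eb|exact: egap].
- by rewrite /surf /in_frame eL eQ eb eg ec et eW eN.
- by rewrite /E1 /in_frame eL eQ eb eg et eW eN.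
- by rewrite /E2 /in_frame eL eQ eb eg et eW eN.
- by rewrite /E3 /in_frame eL eQ eb eg et eW eN.
- by rewrite /speed eL eQ eb eg ekg ekn eg'.
Qed.

Lemma shearE u : shear u = gamma (Sof u) * (2 * Lof u - kg (Sof u) * Lof u ^+ 2) / den u.
Proof. by []. Qed.

Lemma gammaE s : gamma s = - (kn^`()^`() s + kn^`() s * expR (kn^`() s)) / 2.
Proof. by []. Qed.

Lemma denE u : den u = 1 + Lof u ^+ 2 * (beta (Sof u) ^+ 2 + gamma (Sof u) ^+ 2).
Proof. by []. Qed.

Lemma E1_dotp u : dotp (E1 u) (t (Sof u)) =
  1 - 2 * gamma (Sof u) * (Lof u ^+ 2 * gamma (Sof u) / den u).
Proof. exact: dotp_comb1 (bf_oframe bf (Sof u)) _ _ _. Qed.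

Lemma same_point_0L l : same_point (pt 0 l) (pt L l).
Proof. by split; [rewrite !pt1 | exists 1; rewrite !pt0 add0r mul1r]. Qed.

Lemma speed_Ck k : Ck k speed.
Proof.
have CL : Ck k (fun u : 'rV[R]_2 => Lof u) by exact: Ck_coord.
have pull f : smooth f -> Ck k (fun u : 'rV[R]_2 => f (Sof u)).
  by move=> Cf; apply: Ck_comp; [exact: Cf | exact: Ck_coord].
have Cb := pull _ smooth_beta; have Cg := pull _ smooth_gamma.
have Cg' := pull _ (smooth_derive1 smooth_gamma).
have [/pull Ckg /pull Ckn] := bf_smooth_curv bf.
apply: CkM; last first.
  apply: CkV => [u|]; first by rewrite gt_eqF // den_gt0.
  apply: CkD; first exact: Ck_cst.
  by apply: CkM; [exact: CkX | apply: CkD; exact: CkX].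
apply: CkD; first by apply: CkB; [exact: Ck_cst | exact: CkM].
apply: CkM; last exact: CkX.
apply: CkB; last exact: CkM.
by apply: CkD Cg'; apply: CkB; exact: CkX.
Qed.

(** * Embeddedness of a thin strip *)

Local Opaque surf E1 E2 E3 speed shear den beta gamma curv_gap.

Hypothesis hc : closed_Frenet_curve L c.

Lemma L_gt0 : 0 < L. Proof. exact: frenet_length_gt0 hc. Qed.

Lemma reduce_mod (a s : R) : exists m : int, a <= s + m%:~R * L < a + L.
Proof.
exists (- Num.floor ((s - a) / L)).
have L0 := L_gt0.
have /andP[h1 h2] := floor_itv ((s - a) / L).
rewrite rmorphN /= mulNr.
move: h1 h2; rewrite ler_pdivlMr // ltr_pdivrMr // intrD.
by move=> h1 h2; apply/andP; split; lra.
Qed.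

Lemma int_mulL_eq0 (m : int) : `|m%:~R * L| < L -> m = 0.
Proof.
have L0 := L_gt0.
rewrite normrM (gtr0_norm L0) gtr_pMl // -intr_norm -[1]/(1%:~R) ltr_int.
by rewrite -abszE ltz_nat ltnS leqn0 absz_eq0 => /eqP.
Qed.

Lemma curve_inj s s' : c s = c s' -> exists m : int, s' = s + m%:~R * L.
Proof.
move=> ess'; have [pc _ _ _] := bf_periodic bf.
have [m hm] := reduce_mod 0 s; have [m' hm'] := reduce_mod 0 s'.
rewrite add0r in hm hm'.
have : s + m%:~R * L = s' + m'%:~R * L.
  by apply: (frenet_simple hc); rewrite ?in_itv //= !(periodicz pc).
move=> e; exists (m - m'); rewrite intrB mulrBl; lra.
Qed.

Lemma continuous_derive_surf a : continuous ('D_a surf).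
Proof.
move=> u; apply: continuous_rowP => j.
rewrite (_ : (fun u => _) = 'D_a (fun u => surf u 0 j)).
  exact: (Ck_continuous (Ck_derive a (surf_Ck 1 j))).
apply/funext => v; rewrite derive_mx ?mxE //.
by have [] := is_derive_surf v a.
Qed.

Lemma derive_surf_coord u : 'D_(pt 1 0) surf u = in_E u (speed u) (shear u) 0 /\
  'D_(pt 0 1) surf u = in_E u 0 (den u)^-1 0.
Proof.
have [h1 h2] := (derive_surf u (pt 1 0), derive_surf u (pt 0 1)).
have [p1 p2] := (pt0 (1 : R) 0, pt1 (1 : R) 0).
have [p3 p4] := (pt0 (0 : R) 1, pt1 (0 : R) 1).
rewrite {}h1 {}h2 p1 p2 p3 p4; split; congr in_E; ring.
Qed.

Lemma surf_locally_injective s : exists2 e : R, 0 < e & forall v w : 'rV[R]_2,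
  `|Sof v - s| < e -> `|Lof v - 0| < e ->
  `|Sof w - s| < e -> `|Lof w - 0| < e -> surf v = surf w -> v = w.
Proof.
have [e1 e2] := derive_surf_coord (pt s 0).
have fr := E_oframe (pt s 0).
have [e e0 inj] : exists2 e : R, 0 < e & forall v w : 'rV[R]_2,
    `|Sof v - Sof (pt s 0)| < e -> `|Lof v - Lof (pt s 0)| < e ->
    `|Sof w - Sof (pt s 0)| < e -> `|Lof w - Lof (pt s 0)| < e ->
    surf v = surf w -> v = w.
  have h1 v a :
      is_derive v a surf (Sof a *: 'D_(pt 1 0) surf v + Lof a *: 'D_(pt 0 1) surf v).
    apply: (is_derive_eq (is_derive_surf v a)).
    have [-> ->] := derive_surf_coord v.
    rewrite /in_E /comb; move: (E1 v) (E2 v) (E3 v) => f1 f2 f3.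
    by apply/rowP => j; rewrite !mxE; ring.
  have h2 : dotp ('D_(pt 1 0) surf (pt s 0)) ('D_(pt 1 0) surf (pt s 0)) = 1.
    by rewrite e1 speed_pt0 shear_pt0 /in_E (dotp_comb fr); ring.
  have h3 : dotp ('D_(pt 1 0) surf (pt s 0)) ('D_(pt 0 1) surf (pt s 0)) = 0.
    by rewrite e1 e2 speed_pt0 shear_pt0 /in_E (dotp_comb fr); ring.
  have h4 : dotp ('D_(pt 0 1) surf (pt s 0)) ('D_(pt 0 1) surf (pt s 0)) = 1.
    by rewrite e2 den_pt0 invr1 /in_E (dotp_comb fr); ring.
  have c1 : {for pt s 0, continuous ('D_(pt 1 0) surf)} by exact: continuous_derive_surf.
  have c2 : {for pt s 0, continuous ('D_(pt 0 1) surf)} by exact: continuous_derive_surf.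
  exact: (locally_injective h1 c1 c2 h2 h3 h4).
exists e; first exact: e0.
by move=> v w; have := inj v w; have [-> ->] := (pt0 s 0, pt1 s 0); apply.
Qed.

Lemma same_point_shift u (m : int) : same_point u (pt (Sof u + m%:~R * L) (Lof u)).
Proof. by split; [exact: pt1 | exists m; exact: pt0]. Qed.

(** Reduces injectivity modulo the period to pairs of points whose first coordinates
    are s in [0, L] and s + h with |h| <= L / 2: these pairs form a compact set. *)
Lemma injective_mod_period (d : R) :
  (forall s h l l', s \in `[0, L] -> h \in `[- (L / 2), L / 2] ->
    `|l| <= d -> `|l'| <= d -> surf (pt s l) = surf (pt (s + h) l') -> h = 0 /\ l = l') ->
  forall u u', `|Lof u| <= d -> `|Lof u'| <= d -> surf u = surf u' -> same_point u u'.
Proof.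
have L0 := L_gt0.
have arith0 (x : R) : - (L / 2) <= x < - (L / 2) + L -> x \in `[- (L / 2), L / 2].
  by rewrite in_itv /= => /andP[-> h] /=; lra.
have arith1 (x : R) : 0 <= x < L -> x \in `[0, L].
  by rewrite in_itv /= => /andP[-> /ltW].
have arith2 (x y z w : R) : x + z + (y - (x + z) + w) = y + w by ring.
have arith3 (x y z w : R) : y - (x + z) + w = 0 -> y = x + (z - w) by lra.
move=> inj u u' ud u'd eq.
have [m hm] := reduce_mod 0 (Sof u); rewrite add0r in hm.
have [m' hm'] := reduce_mod (- (L / 2)) (Sof u' - (Sof u + m%:~R * L)).
have [[e1 _ _ _] _] := same_point_eq (same_point_shift u m).
have [[e2 _ _ _] _] := same_point_eq (same_point_shift u' m').
have [h1 h2] : Sof u' - (Sof u + m%:~R * L) + m'%:~R * L = 0 /\ Lof u = Lof u'.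
  apply: (inj _ _ _ _ (arith1 _ hm) (arith0 _ hm') ud u'd).
  apply: (etrans e1); apply: (etrans eq); apply: (etrans (esym e2)).
  congr (surf (pt _ _)).
  exact: esym (arith2 (Sof u) (Sof u') (m%:~R * L) (m'%:~R * L)).
split; first exact: esym h2.
by exists (m - m'); rewrite intrB mulrBl; exact: arith3 h1.
Qed.

(** By compactness of the set of pairs (s, h), it suffices to separate the points
    near a given pair: for h = 0 by local injectivity, for h <> 0 because the
    simple curve c takes distinct values at s and s + h. *)
Lemma injective_near_axis :
  \forall d \near 0^'+, forall u u', `|Lof u| <= d -> `|Lof u'| <= d ->
    surf u = surf u' -> same_point u u'.
Proof.
have aux0 (x y : R) : x = x + y -> y = 0 by lra.
have L0 := L_gt0.
pose K := `[0, L]%classic `*` `[- (L / 2), L / 2]%classic : set (R * R).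
have cK : compact K by apply: compact_setX; exact: segment_compact.
pose P (d : R) (z : R * R) := forall l l', `|l| <= d -> `|l'| <= d ->
  surf (pt z.1 l) = surf (pt (z.1 + z.2) l') -> z.2 = 0 /\ l = l'.
have dlt (e : R) : 0 < e -> \forall d \near 0^'+, d < e.
  by move=> e0; exact: nbhs_right_lt.
have [cs0 cplus] : (forall x : R * R, {for x, continuous (fun z : R * R => z.1)}) /\
    (forall x : R * R, {for x, continuous (fun z : R * R => z.1 + z.2)}).
  split=> x; first exact: cvg_fst.
  by apply: cvgD; [exact: cvg_fst | exact: cvg_snd].
have near1 (f : R * R -> R) (x : R * R) (e : R) : 0 < e -> {for x, continuous f} ->
    \forall z \near x, `|f z - f x| < e.
  move=> e0 cf; near=> z; rewrite distrC; near: z.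
  exact: cvgr_dist_lt cf _ e0.
have nearP : forall z, K z -> \forall z' \near z & d \near 0^'+, P d z'.
  move=> [s h] [/= _ hh].
  have [h0|h0] := eqVneq h 0.
    have [e e0 inj] := surf_locally_injective s.
    have n1 := near1 _ (s, h) e e0 (cs0 _); have n2 := near1 _ (s, h) e e0 (cplus _).
    exists ([set z | `|z.1 - s| < e /\ `|z.1 + z.2 - (s + h)| < e], [set d | d < e]).
      by split=> /=; [apply: filterI | apply: dlt].
    move=> [[s1 h1] d] [[/= a1 a2] de] l l' ld l'd eq.
    have : pt s1 l = pt (s1 + h1) l'.
      apply: inj eq; rewrite ?pt0 ?pt1 ?subr0 //.
      - exact: le_lt_trans de.
      - by move: a2; rewrite h0 addr0.
      - exact: le_lt_trans de.
    by move=> /pt_inj[hs ->]; split; [exact: aux0 hs|].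
  have nc : c s != c (s + h).
    apply/eqP => /curve_inj[m] /addrI hm.
    move: h0; rewrite hm; move: hh; rewrite hm /= in_itv /= => hh.
    rewrite (int_mulL_eq0 (m := m)) ?mul0r ?eqxx //.
    by rewrite ltr_norml; apply/andP; split; lra.
  have := @norm_hausdorff R 'rV[R]_3; rewrite open_hausdorff => /(_ _ _ nc).
  move=> [[A B] [/= Ac Bc] [oA oB /eqP AB0]].
  have hA : nbhs (pt s 0) (surf @^-1` A).
    apply: surf_continuous; rewrite surf_pt0; apply: open_nbhs_nbhs; split=> //.
    by rewrite inE in Ac.
  have hB : nbhs (pt (s + h) 0) (surf @^-1` B).
    apply: surf_continuous; rewrite surf_pt0; apply: open_nbhs_nbhs; split=> //.
    by rewrite inE in Bc.
  have [e1 e10 h1] := (nbhs_row2P _ _).1 hA; have [e2 e20 h2] := (nbhs_row2P _ _).1 hB.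
  have n1 := near1 _ (s, h) e1 e10 (cs0 _); have n2 := near1 _ (s, h) e2 e20 (cplus _).
  exists ([set z | `|z.1 - s| < e1 /\ `|z.1 + z.2 - (s + h)| < e2],
          [set d | d < e1 /\ d < e2]).
    by split=> /=; apply: filterI => //; apply: dlt.
  move=> [[s1 h1'] d] [[/= a1 a2] [de1 de2]] l l' ld l'd eq.
  have Au : A (surf (pt s1 l)).
    by apply: h1; [rewrite !pt0 | rewrite !pt1 subr0; exact: le_lt_trans de1].
  have Bu : B (surf (pt s1 l)).
    by rewrite eq; apply: h2; [rewrite !pt0 | rewrite !pt1 subr0; exact: le_lt_trans de2].
  have AB : (A `&` B) (surf (pt s1 l)) := conj Au Bu.
  by exfalso; rewrite AB0 in AB.
have : \forall d \near 0^'+, K `<=` P d.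
  exact: (compact_near_coveringP K).1 cK R 0^'+ P _ nearP.
apply: filterS => d KP; apply: injective_mod_period => s h l l' s0L hL.
by apply: (KP (s, h)); split.
Unshelve. all: by end_near. Qed.
Implicit Types (v : 'rV[R]_2).

Lemma speed_gt0_near_axis : \forall d \near 0^'+, forall u, `|Lof u| <= d -> 0 < speed u.
Proof.
have L0 := L_gt0.
pose P (d s : R) := forall l, `|l| <= d -> 0 < speed (pt s l).
have nearP : forall s, `[0, L]%classic s -> \forall s' \near s & d \near 0^'+, P d s'.
  move=> s _.
  have h : nbhs (pt s 0) [set v | 0 < speed v].
    have cs : {for pt s 0, continuous speed} by exact: (Ck_continuous (speed_Ck 0)).
    apply: (cvgr_gt _ cs).
    by rewrite speed_pt0 ltr01.
  have [e e0 he] := (nbhs_row2P _ _).1 h.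
  exists ([set z | `|z - s| < e], [set d | d < e]).
    split=> /=; last exact: nbhs_right_lt.
    by apply/nbhs_ballP; exists e => // z /=; rewrite /ball /= distrC.
  move=> [s' d] [/= a1 de] l ld; apply: he; rewrite ?pt0 ?pt1 ?subr0; first exact: a1.
  exact: le_lt_trans ld de.
have : \forall d \near 0^'+, `[0, L]%classic `<=` P d.
  exact: (compact_near_coveringP _).1 (@segment_compact R 0 L) R 0^'+ P _ nearP.
apply: filterS => d KP u ud.
have [m hm] := reduce_mod 0 (Sof u); rewrite add0r in hm.
have [_ [<- _ _]] := same_point_eq (same_point_shift u m).
by apply: KP ud; rewrite /= in_itv /=; case/andP: hm => -> /ltW.
Qed.

Lemma exists_strip : exists2 d : R, 0 < d &
  (forall u u', `|Lof u| <= d -> `|Lof u'| <= d -> surf u = surf u' -> same_point u u') /\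
  (forall u, `|Lof u| <= d -> 0 < speed u).
Proof.
near (0 : R)^'+ => d.
exists d; first by near: d; exact: nbhs_right_gt.
by split; near: d; [exact: injective_near_axis | exact: speed_gt0_near_axis].
Unshelve. all: by end_near. Qed.

(** * Atlas and orientation *)

Variable de : R.
Hypothesis de_gt0 : 0 < de.
Hypothesis de_inj : forall u u', `|Lof u| <= de -> `|Lof u'| <= de ->
  surf u = surf u' -> same_point u u'.
Hypothesis de_speed : forall u, `|Lof u| <= de -> 0 < speed u.

Definition strip := [set u : 'rV[R]_2 | `|Lof u| < de].
(** All the charts are restrictions of [surf], to strips over intervals of length L. *)
Definition chart_dom (a : R) := [set u : 'rV[R]_2 | a < Sof u < a + L /\ `|Lof u| < de].
Definition canal_support := surf @` strip.

Lemma open_coord (j : 'I_2) (A : set R) : open A -> open [set u : 'rV[R]_2 | A (u 0 j)].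
Proof. by move=> oA; apply: open_comp oA => u _; exact: coord_continuous. Qed.

Lemma chart_dom_open (a : R) : open (chart_dom a).
Proof.
rewrite (_ : chart_dom a = [set u | `]a, a + L[%classic (Sof u)] `&`
                           [set u | `]- de, de[%classic (Lof u)]).
  by apply: openI; apply: open_coord; exact: interval_open.
by apply/seteqP; split=> u; rewrite /chart_dom /= !in_itv /= ltr_norml.
Qed.

Lemma chart_inj (a : R) u v : chart_dom a u -> a <= Sof v <= a + L -> `|Lof v| <= de ->
  surf u = surf v -> u = v.
Proof.
have arith (x y z : R) : a < x < a + L -> a <= x + z <= a + L -> `|z| < L.
  by move=> /andP[? ?] /andP[? ?]; rewrite ltr_norml; apply/andP; split; lra.
move=> [hS hL] hS' hL' euv.
have [eL [m eS]] := de_inj (ltW hL) hL' euv.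
rewrite eS in hS'; rewrite (int_mulL_eq0 (arith _ 0 _ hS hS')) mul0r addr0 in eS.
exact: row2P (esym eS) (esym eL).
Qed.

Lemma chart_cover (a : R) u : strip u ->
  exists2 v, same_point u v & a <= Sof v < a + L /\ strip v.
Proof.
move=> uS; have [m hm] := reduce_mod a (Sof u).
exists (pt (Sof u + m%:~R * L) (Lof u)); first exact: same_point_shift.
by rewrite /strip /= pt0 pt1; split.
Qed.

Lemma compact_box (a : R) :
  compact [set v : 'rV[R]_2 | a <= Sof v <= a + L /\ `|Lof v| <= de].
Proof.
pose A (i : 'I_2) : set R := if i == 0 then `[a, a + L]%classic else `[- de, de]%classic.
have cA i : compact (A i) by rewrite /A; case: ifP => _; exact: segment_compact.
have := rV_compact cA; congr compact; apply/seteqP; split=> v /=.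
  move=> h; have := h 0; have := h 1; rewrite /A /= !in_itv /= => h1 h0.
  by rewrite ler_norml; split.
rewrite ler_norml => -[h0 h1] i; rewrite /A; case: ifPn => [/eqP ->|i0].
  by rewrite /= in_itv.
have -> : i = 1 by case: i i0 => -[|[|j]] hj //= _; apply: val_inj.
by rewrite /= in_itv.
Qed.

(** The complement of O in a closed box over one period is compact, so its image
    is closed; it misses the image of O because [surf] is injective modulo the
    period, and both images together cover the surface. *)
Lemma surf_open (a : R) (O : set 'rV[R]_2) : open O -> O `<=` chart_dom a ->
  exists2 V, open V & V `&` canal_support = surf @` O.
Proof.
move=> oO Oa.
pose B := [set v : 'rV[R]_2 | a <= Sof v <= a + L /\ `|Lof v| <= de] `\` O.
have cB : compact B.
  rewrite /B setDE; apply: compact_closedI; first exact: compact_box.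
  exact: open_closedC.
have cS : compact (surf @` B).
  by apply: continuous_compact cB; apply: continuous_subspaceT; exact: surf_continuous.
exists (~` (surf @` B)).
  by apply: closed_openC; apply: compact_closed cS; exact: norm_hausdorff.
apply/seteqP; split=> p.
  move=> [nB [u us eup]]; have [v euv [hv vs]] := chart_cover a us.
  have [[euv' _ _ _] _] := same_point_eq euv.
  have [Ov|nO] := pselect (O v); first by exists v; [exact: Ov | exact: etrans euv' eup].
  exfalso; apply: nB; exists v; last exact: etrans euv' eup.
  split; last exact: nO.
  split; last exact: ltW.
  by case/andP: hv => -> /ltW.
move=> [u Ou <-]; have au := Oa u Ou; split; last by exists u => //; exact: au.2.
move=> [v [[hS hL] nOv] euv]; apply: nOv.
by rewrite -(chart_inj au hS hL (esym euv)).
Qed.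

Definition chart_inv (a : R) (p : 'rV[R]_3) : 'rV[R]_2 :=
  xget 0 [set u | chart_dom a u /\ surf u = p].

Lemma chart_invK (a : R) u : chart_dom a u -> chart_inv a (surf u) = u.
Proof.
move=> au; rewrite /chart_inv; apply: xget_unique; first by split.
move=> v [av evu]; apply: chart_inj av _ (ltW au.2) evu.
by case/andP: au.1 => /ltW -> /ltW.
Qed.

Lemma E3_same_point u v : strip u -> strip v -> surf u = surf v -> E3 v = E3 u.
Proof.
move=> us vs euv; have eq := de_inj (ltW us) (ltW vs) euv.
by have [[_ _ _ ->] _] := same_point_eq eq.
Qed.

Definition canal_normal (p : 'rV[R]_3) : 'rV[R]_3 :=
  xget 0 [set w | exists u, [/\ strip u, surf u = p & E3 u = w]].

Lemma canal_normal_surf u : strip u -> canal_normal (surf u) = E3 u.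
Proof.
move=> us; rewrite /canal_normal; apply: xget_unique; first by exists u.
by move=> w [v [vs evu <-]]; exact: E3_same_point us vs (esym evu).
Qed.

Lemma param_normal_surf u : strip u -> param_normal surf u = E3 u.
Proof.
move=> us; have s0 := de_speed (ltW us); have q0 := den_gt0 u.
have fr := E_oframe u.
rewrite /param_normal.
have -> : 'D_(delta_mx 0 0) surf u = in_E u (speed u) (shear u) 0.
  by rewrite derive_surf !mxE /= !mul1r mul0r addr0.
have -> : 'D_(delta_mx 0 1) surf u = in_E u 0 (den u)^-1 0.
  by rewrite derive_surf !mxE /= !mul0r mul1r add0r.
rewrite /in_E (crossp_comb fr).
have -> : comb (E1 u) (E2 u) (E3 u) (shear u * 0 - 0 / den u) (0 * 0 - speed u * 0)
   (speed u / den u - shear u * 0) = (speed u / den u) *: E3 u.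
  have z1 : shear u * 0 - 0 / den u = 0 by ring.
  have z2 : 0 * 0 - speed u * 0 = 0 by ring.
  have z3 : speed u / den u - shear u * 0 = speed u / den u by ring.
  by rewrite z1 z2 z3 /comb !scale0r !add0r.
have [[_ _ h] _] := oframe_dotp fr.
have sq0 : 0 < speed u / den u by apply: divr_gt0.
rewrite /enorm dotpZl dotpZr h mulr1 -expr2 sqrtr_sqr (gtr0_norm sq0) scalerA.
by rewrite mulVf ?scale1r // gt_eqF.
Qed.

Variable r : nat.

Definition chart_atlas : set (set 'rV[R]_2 * ('rV[R]_2 -> 'rV[R]_3)) :=
  [set Ux | exists a : R, Ux = (chart_dom a, surf)].

Lemma chart_local_parametrization U x : chart_atlas (U, x) ->
  local_parametrization r canal_support U x.
Proof.
move=> [a [-> ->]].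
split.
- exact: chart_dom_open.
- by apply: class_C_coord => j; exact: surf_Ck.
- move=> u v [_ uL]; rewrite derive_surf => e.
  have e0 : in_E u (Sof v * speed u) (Sof v * shear u + Lof v / den u) 0 = in_E u 0 0 0.
    by rewrite e /in_E /comb !scale0r !addr0.
  have [h1 h2 _] := comb_inj (E_oframe u) e0.
  have s0 : Sof v = 0.
    apply/eqP; move/eqP: h1; rewrite mulf_eq0 => /orP[//|].
    by rewrite gt_eqF // (de_speed (ltW uL)).
  apply: row2P; rewrite mxE; first exact: s0.
  apply/eqP; move/eqP: h2; rewrite s0 mul0r add0r mulf_eq0 invr_eq0 => /orP[//|].
  by rewrite gt_eqF // den_gt0.
- have [V oV eV] := surf_open (@chart_dom_open a) (@subset_refl _ _).
  by exists V.
- exists (chart_inv a); last by move=> u; rewrite inE; exact: chart_invK.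
  apply/subspace_continuousP => p [u au <-].
  rewrite /from_subspace /= (chart_invK au) => B Bu.
  have oO : open (B^° `&` chart_dom a).
    by apply: openI; [exact: open_interior | exact: chart_dom_open].
  have Oa : B^° `&` chart_dom a `<=` chart_dom a by move=> v [].
  have [V oV eV] := surf_open oO Oa.
  have Vu : V (surf u).
    have : (surf @` (B^° `&` chart_dom a)) (surf u) by exists u.
    by rewrite -eV => -[].
  have nV : nbhs (surf u) V by apply: open_nbhs_nbhs.
  apply: filterS nV => p' Vp' [v av evp'].
  have : (V `&` canal_support) p'.
    by split=> //; exists v => //; exact: av.2.
  rewrite eV => -[w [Bw aw] <-] /=.
  by rewrite chart_invK //; exact: interior_subset Bw.
Qed.

Lemma chart_atlas_cover p : canal_support p ->
  exists U x u, [/\ chart_atlas (U, x), U u & x u = p].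
Proof.
move=> [u us <-]; exists (chart_dom (Sof u - L / 2)), surf, u; split=> //.
  by exists (Sof u - L / 2).
by split=> //; have L0 := L_gt0; apply/andP; split; lra.
Qed.

Lemma chart_atlas_oriented U x u : chart_atlas (U, x) -> U u ->
  canal_normal (x u) = param_normal x u.
Proof.
by move=> [a [-> ->]] [_ us]; rewrite canal_normal_surf // param_normal_surf.
Qed.

Definition canal_surface : oriented_surface R r :=
  OrientedSurface chart_local_parametrization chart_atlas_cover chart_atlas_oriented.

(** * Principal curvatures and principal directions *)

Definition k_min u := 2 * beta (Sof u).
Definition k_max u := 2 * beta (Sof u) + curv_gap (Sof u) / speed u.

Lemma k_lt u : strip u -> k_min u < k_max u.
Proof.
move=> us; rewrite /k_max ltrDl; apply: divr_gt0; first exact: curv_gap_gt0.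
exact: de_speed (ltW us).
Qed.

Lemma dotp_in_E u (x y x' y' : R) :
  dotp (in_E u x y 0) (in_E u x' y' 0) = x * x' + y * y'.
Proof. by rewrite /in_E (dotp_comb (E_oframe u)) mulr0 addr0. Qed.

Lemma strip_open : open strip.
Proof.
rewrite (_ : strip = [set u | `]- de, de[%classic (Lof u)]).
  by apply: open_coord; exact: interval_open.
by apply/seteqP; split=> u; rewrite /strip /= !in_itv /= ltr_norml.
Qed.

Lemma derive_canal_normal_surf u a : strip u ->
  'D_a (canal_normal \o surf) u =
  in_E u (- (Sof a * curv_gap (Sof u)) - 2 * beta (Sof u) * (Sof a * speed u))
      (- (2 * beta (Sof u) * (Sof a * shear u + Lof a / den u))) 0.
Proof.
move=> us; have [_ <-] := is_derive_E3 u a.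
apply: near_eq_derive.
have : nbhs u strip by apply: open_nbhs_nbhs; split; [exact: strip_open|].
by apply: filterS => v vs; exact: canal_normal_surf.
Qed.

Lemma second_form_surf u a : strip u ->
  second_form canal_surface surf u a a =
  2 * beta (Sof u) * first_form surf u a a + Sof a * curv_gap (Sof u) * (Sof a * speed u).
Proof.
move=> us; rewrite /second_form /first_form.
rewrite (_ : positive_normal canal_surface = canal_normal); last by [].
rewrite (derive_canal_normal_surf a us) derive_surf dotpNl !dotp_in_E; ring.
Qed.

Lemma tangent_coord u (x y : R) : 0 < speed u ->
  exists a, Sof a * speed u = x /\ Sof a * shear u + Lof a / den u = y.
Proof.
move=> s0; have q0 := den_gt0 u.
exists (pt (x / speed u) ((y - x / speed u * shear u) * den u)).
have [-> ->] := (pt0 (x / speed u) ((y - x / speed u * shear u) * den u),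
                 pt1 (x / speed u) ((y - x / speed u * shear u) * den u)).
by split; field; rewrite ?gt_eqF // q0.
Qed.

(** Euler's formula. The chart and its point in the definition of the normal curvature
    are arbitrary, but the frame and the curvatures depend on s modulo L only. *)
Lemma normal_curvatureP u e k : strip u ->
  normal_curvature canal_surface (surf u) e k <->
  exists x y, [/\ x * x + y * y = 1, e = in_E u x y 0 &
                  k = k_min u + curv_gap (Sof u) / speed u * (x * x)].
Proof.
move=> us; split.
  move=> [U [X [v [a [[[b [-> ->]] vU] evu <- h1 <-]]]]].
  have vs : strip v by exact: vU.2.
  have euv := de_inj (ltW us) (ltW vs) (esym evu).
  have [[_ e1 e2 e3] [es eb eg]] := same_point_eq euv.
  have s0 := de_speed (ltW us).
  exists (Sof a * speed v), (Sof a * shear v + Lof a / den v); split.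
  - by rewrite -(dotp_in_E v) -derive_surf; exact: h1.
  - by rewrite derive_surf /in_E e1 e2 e3.
  rewrite (second_form_surf a vs) h1 mulr1 /k_min -eb -eg -es.
  by rewrite -es in s0; field; rewrite gt_eqF.
move=> [x [y [h1 -> ->]]].
have [U [X [v [[b [-> ->]] vU evu]]]] :=
  chart_atlas_cover (ex_intro2 _ _ u us erefl : canal_support (surf u)).
have vs : strip v by exact: vU.2.
have euv := de_inj (ltW us) (ltW vs) (esym evu).
have [[_ e1 e2 e3] [es eb eg]] := same_point_eq euv.
have s0 := de_speed (ltW vs); have q0 := den_gt0 v.
have [a [xE yE]] := tangent_coord x y s0.
have hI : first_form surf v a a = 1 by rewrite /first_form derive_surf xE yE dotp_in_E.
exists (chart_dom b), surf, v, a; split.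
- by split; [exists b | exact: vU].
- exact: evu.
- by rewrite derive_surf xE yE /in_E e1 e2 e3.
- exact: hI.
rewrite (second_form_surf a vs) hI mulr1 /k_min -eb -eg -es -xE.
by field; rewrite gt_eqF.
Qed.

Lemma principal_max u : strip u ->
  principal_curvature canal_surface Maximal (surf u) (k_max u).
Proof.
move=> us; have g0 : 0 < curv_gap (Sof u) / speed u.
  by apply: divr_gt0; [exact: curv_gap_gt0 | exact: de_speed (ltW us)].
split.
  exists (in_E u 1 0 0); apply/(normal_curvatureP _ _ us); exists 1, 0; split=> //.
    by rewrite mulr1 mulr0 addr0.
  by rewrite /k_max /k_min !mulr1.
move=> e k /(normal_curvatureP _ _ us)[x [y [h1 _ ->]]].
rewrite /k_max /k_min lerD2l ger_pMr // -h1.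
by have := sqr_ge0 y; rewrite expr2 => h; rewrite lerDl.
Qed.

Lemma not_umbilic u : strip u -> ~ umbilic canal_surface (surf u).
Proof.
move=> us [k [[_ kmin] [_ kmax]]].
have h1 : normal_curvature canal_surface (surf u) (in_E u 0 1 0) (k_min u).
  apply/(normal_curvatureP _ _ us); exists 0, 1; split=> //.
    by rewrite mulr0 add0r mulr1.
  by rewrite !mulr0 addr0.
have [[e h2] _] := principal_max us.
have := le_trans (kmax _ _ h2) (kmin _ _ h1).
by rewrite leNgt k_lt.
Qed.

Lemma principal_vector_E1 u (l : R) : strip u -> l != 0 ->
  principal_vector canal_surface Maximal (surf u) (l *: E1 u).
Proof.
move=> us l0; exists (k_max u), (E1 u), l; split=> //; first exact: principal_max.
apply/(normal_curvatureP _ _ us); exists 1, 0; split.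
- by rewrite mulr1 mulr0 addr0.
- by rewrite /in_E /comb scale1r !scale0r !addr0.
- by rewrite /k_max /k_min !mulr1.
Qed.

Lemma not_principal_vector_E2 u (l : R) : strip u -> l != 0 ->
  ~ principal_vector canal_surface Maximal (surf u) (l *: E2 u).
Proof.
move=> us l0 [k [e [m [[_ kmax] /(normal_curvatureP _ _ us)[x [y [h1 -> kE]]] m0 eq]]]].
have g0 : 0 < curv_gap (Sof u) / speed u.
  by apply: divr_gt0; [exact: curv_gap_gt0 | exact: de_speed (ltW us)].
have [[e0 h2] _] := principal_max us.
have := kmax _ _ h2; rewrite kE /k_max /k_min lerD2l ler_pMr // => x1.
have y0 : y = 0.
  apply/eqP; rewrite -sqrf_eq0 eq_le sqr_ge0 andbT expr2.
  by move: x1; rewrite -h1 gerDl.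
have eq' : in_E u 0 l 0 = in_E u (m * x) 0 0.
  rewrite y0 in eq; move: eq; rewrite /in_E /comb !scale0r !addr0 add0r scalerA => -> //.
have [hx hl _] := comb_inj (E_oframe u) eq'.
by move: l0; rewrite hl eqxx.
Qed.

(** * Integrating the principal foliation *)

Variables (G J : R -> R).
Hypothesis dG : forall s, is_derive s (1 : R) G (2 * gamma s).
Hypothesis G0 : G 0 = 0.
Hypothesis dJ : forall s, is_derive s (1 : R) J (gamma s * kg s * expR (- G s)).
Hypothesis J0 : J 0 = 0.

(** The solution of the Riccati equation with value w at 0: its inverse
    exp (G) (1 / w - J) solves a linear equation. *)
Definition leaf_coord (w s : R) := w * expR (- G s) / (1 - w * J s).

Lemma is_derive_leaf_coord (w s : R) : 1 - w * J s != 0 ->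
  is_derive s (1 : R) (leaf_coord w)
    (- gamma s * (2 * leaf_coord w s - kg s * leaf_coord w s ^+ 2)).
Proof.
move=> n0.
have hE := @is_derive_chain _ _ expR (fun s => - G s) s 1 _ _
  (is_derive_expR _) (is_deriveN' (dG s)).
have hw := is_derive_cst' w s (1 : R).
have hD := is_deriveB' (is_derive_cst' (1 : R) s 1) (is_deriveM' hw (dJ s)).
have hV := @is_deriveV' _ _ (fun s => 1 - w * J s) s 1 _ n0 hD.
have h := is_deriveM' (is_deriveM' hw hE) hV.
by apply: (is_derive_eq h); rewrite /leaf_coord; field.
Qed.

Definition leaf (w s : R) := surf (pt s (leaf_coord w s)).

Lemma is_derive_pt (f g : R -> R) s f' g' :
  is_derive s (1 : R) f f' -> is_derive s (1 : R) g g' ->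
  is_derive s (1 : R) (fun s => pt (f s) (g s)) (pt f' g').
Proof.
move=> hf hg; apply/is_derive_rowP => j; rewrite mxE.
rewrite (_ : (fun y => _) = if j == 0 then f else g); first by case: ifP.
by apply/funext => y; rewrite mxE; case: ifP.
Qed.

(** The Riccati equation cancels the E2-component of the velocity. *)
Lemma is_derive_leaf (w s : R) : 1 - w * J s != 0 ->
  is_derive s (1 : R) (leaf w)
    (speed (pt s (leaf_coord w s)) *: E1 (pt s (leaf_coord w s))).
Proof.
move=> n0; have hU := is_derive_pt (is_derive_id s (1 : R)) (is_derive_leaf_coord n0).
have h := is_derive_surf_comp hU; apply: (is_derive_eq h).
have [p0 p1] := (pt0 s (leaf_coord w s), pt1 s (leaf_coord w s)).
have q0 := den_gt0 (pt s (leaf_coord w s)).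
set u := pt s (leaf_coord w s) in p0 p1 q0 *.
rewrite !pt0 !pt1 mul1r mul1r.
have -> : shear u +
    - gamma s * (2 * leaf_coord w s - kg s * leaf_coord w s ^+ 2) / den u = 0.
  by rewrite shearE p0 p1; field; rewrite gt_eqF.
by rewrite /in_E /comb !scale0r !addr0.
Qed.

Lemma leaf_principal_arc (w : R) :
  (forall s, s \in `[0, L] -> 1 - w * J s != 0) ->
  (forall s, s \in `[0, L] -> `|leaf_coord w s| < de) ->
  principal_arc canal_surface Maximal (leaf w) 0 L.
Proof.
move=> n0 small.
have dl s : s \in `[0, L] -> is_derive s (1 : R) (leaf w)
    (speed (pt s (leaf_coord w s)) *: E1 (pt s (leaf_coord w s))).
  by move=> sL; apply: is_derive_leaf; exact: n0.
have us s : s \in `[0, L] -> strip (pt s (leaf_coord w s)).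
  by move=> sL; rewrite /strip /= pt1; exact: small.
split; last first.
  move=> s sL; have [d1 d2] := dl s sL; split; first exact: d1.
  - by exists (pt s (leaf_coord w s)); [exact: us|].
  - exact: not_umbilic (us s sL).
  - rewrite derive1E d2; apply: principal_vector_E1; first exact: us.
    by rewrite gt_eqF //; apply: de_speed; exact: ltW (us s sL).
(* By the chain rule the velocity is a combination of the partial derivatives of surf,
   which are continuous. *)
pose h s : 'rV[R]_3 := 'D_(pt 1 0) surf (pt s (leaf_coord w s)) +
  (- gamma s * (2 * leaf_coord w s - kg s * leaf_coord w s ^+ 2))
    *: 'D_(pt 0 1) surf (pt s (leaf_coord w s)).
have hE : {in `[0, L]%classic, h =1 (leaf w)^`()}.
  move=> s; rewrite inE /= => sL; have [_ d2] := dl s sL; rewrite derive1E d2 /h.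
  have [-> ->] := derive_surf_coord (pt s (leaf_coord w s)).
  have [p0 p1] := (pt0 s (leaf_coord w s), pt1 s (leaf_coord w s)).
  have q0 := den_gt0 (pt s (leaf_coord w s)).
  set u := pt s (leaf_coord w s) in p0 p1 q0 *.
  have hmu : shear u = gamma s * (2 * leaf_coord w s - kg s * leaf_coord w s ^+ 2) / den u.
    by rewrite shearE p0 p1.
  rewrite /in_E hmu /comb !scale0r !addr0 add0r scalerA -addrA -scalerDl.
  have -> : gamma s * (2 * leaf_coord w s - kg s * leaf_coord w s ^+ 2) / den u +
    - gamma s * (2 * leaf_coord w s - kg s * leaf_coord w s ^+ 2) / den u = 0 by ring.
  by rewrite scale0r addr0.
apply: (subspace_eq_continuous hE).
apply: continuous_in_subspaceT => s; rewrite inE /= => sL.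
have cl : {for s, continuous (leaf_coord w)}.
  apply: differentiable_continuous; apply/derivable1_diffP.
  by have [] := is_derive_leaf_coord (n0 s sL).
have cU : {for s, continuous (fun s => pt s (leaf_coord w s))}.
  apply: continuous_rowP => j.
  rewrite (_ : (fun y => _) = if j == 0 then id else leaf_coord w); last first.
    by apply/funext => y; rewrite mxE; case: ifP.
  by case: ifP => _; [exact: cvg_id | exact: cl].
have cD v : {for s, continuous (fun s => 'D_v surf (pt s (leaf_coord w s)))}.
  have cDs : {for pt s (leaf_coord w s), continuous ('D_v surf)}.
    exact: continuous_derive_surf.
  exact: (continuous_comp cU cDs).
have cga : {for s, continuous gamma} by exact: smooth_continuous smooth_gamma _.
have ckg : {for s, continuous kg} by exact: smooth_continuous (bf_smooth_curv bf).1 _.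
have cl2 : {for s, continuous (fun s => - gamma s *
    (2 * leaf_coord w s - kg s * (leaf_coord w s * leaf_coord w s)))}.
  have c1 : {for s, continuous (fun s => 2 * leaf_coord w s)}.
    exact: (cvgM (cvg_cst (2 : R)) cl).
  have c2 : {for s, continuous (fun s => kg s * (leaf_coord w s * leaf_coord w s))}.
    exact: (cvgM ckg (cvgM cl cl)).
  have c3 : {for s, continuous (fun s =>
      2 * leaf_coord w s - kg s * (leaf_coord w s * leaf_coord w s))}.
    exact: (cvgB c1 c2).
  have c4 : {for s, continuous (fun s => - gamma s)} by exact: (cvgN cga).
  exact: (cvgM c4 c3).
have c1 := cD (pt 1 0); have c2 := cD (pt 0 1).
exact: (cvgD c1 (cvgZ cl2 c2)).
Qed.

Lemma leaf_coord0 w : leaf_coord w 0 = w.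
Proof. by rewrite /leaf_coord G0 J0 oppr0 expR0 mulr0 subr0 mulr1 divr1. Qed.

(** The leaves close to c stay in any prescribed strip during one period: |J| and
    exp (- G) are bounded on [0, L]. *)
Lemma leaf_coord_small (d : R) : 0 < d ->
  \forall w \near (0 : R), forall s, s \in `[0, L] ->
  1 - w * J s != 0 /\ `|leaf_coord w s| < d.
Proof.
move=> d0.
pose f s := `|J s| + expR (- G s).
have cJ : continuous J.
  move=> s; apply: differentiable_continuous; apply/derivable1_diffP.
  by have [] := dJ s.
have cG : continuous G.
  move=> s; apply: differentiable_continuous; apply/derivable1_diffP.
  by have [] := dG s.
have cf : continuous f.
  move=> s; apply: cvgD; first by apply: continuous_comp (cJ s) _; exact: norm_continuous.
  apply: (@continuous_comp _ _ _ (fun s => - G s) expR); last exact: continuous_expR.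
  by apply: cvgN; exact: cG.
have [s0 _ hM] := EVT_max (ltW L_gt0) (continuous_subspaceT cf).
have M0 : 0 < f s0 by rewrite /f ltr_wpDl // expR_gt0.
move: (f s0) hM M0 => M hM M0.
near=> w.
have w1 : `|w| < (2 * M)^-1.
  by near: w; apply: near0_norm_lt; rewrite invr_gt0 mulr_gt0.
have w2 : `|w| < d / (2 * M).
  by near: w; apply: near0_norm_lt; rewrite divr_gt0 // mulr_gt0.
move=> s /hM; rewrite /f => fM.
have e0 := expR_gt0 (- G s).
have wJ : `|w * J s| < 1 / 2.
  rewrite normrM.
  have : `|w| * `|J s| <= `|w| * M by rewrite ler_wpM2l //; lra.
  move=> /le_lt_trans; apply.
  have -> : 1 / 2 = (2 * M)^-1 * M by field; rewrite gt_eqF.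
  by rewrite ltr_pM2r.
have p1 : 1 / 2 < 1 - w * J s by move: wJ; rewrite ltr_norml => /andP[h1 h2]; lra.
have p0 : 0 < 1 - w * J s by lra.
split; first by rewrite gt_eqF.
rewrite /leaf_coord normrM normrM normfV (gtr0_norm p0) (gtr0_norm e0) ltr_pdivrMr //.
have : `|w| * expR (- G s) <= `|w| * M.
  by rewrite ler_wpM2l //; have := normr_ge0 (J s); lra.
move=> /le_lt_trans; apply.
apply: (@lt_trans _ _ (d * (1 / 2))); last by rewrite ltr_pM2l.
have -> : d * (1 / 2) = d / (2 * M) * M by field; rewrite gt_eqF.
by rewrite ltr_pM2r.
Unshelve. all: by end_near. Qed.

Lemma is_derive_leaf_coord_L :
  is_derive (0 : R) (1 : R) (fun w => leaf_coord w L) (expR (- G L)).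
Proof.
have hw : is_derive (0 : R) (1 : R) (fun w : R => w) 1 := is_derive_id _ _.
have hn := is_deriveM' hw (is_derive_cst' (expR (- G L)) (0 : R) 1).
have hD := is_deriveB' (is_derive_cst' (1 : R) (0 : R) 1)
                       (is_deriveM' hw (is_derive_cst' (J L) (0 : R) 1)).
have n0 : 1 - 0 * J L != 0 by rewrite mul0r subr0 oner_neq0.
have hV := @is_deriveV' _ _ (fun w : R => 1 - w * J L) 0 1 _ n0 hD.
apply: (is_derive_eq (is_deriveM' hn hV)).
by rewrite !(mul0r, mulr0, subr0, addr0, mul1r, invr1, mulr1).
Qed.

(** The transversal is the circle through c (0). *)
Definition section_of (w : R) := surf (pt 0 w).

Lemma is_derive_section w :
  is_derive w (1 : R) section_of ((den (pt 0 w))^-1 *: E2 (pt 0 w)).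
Proof.
have hU := is_derive_pt (is_derive_cst' (0 : R) w 1) (is_derive_id w (1 : R)).
have h := is_derive_surf_comp hU; apply: (is_derive_eq h).
have [-> ->] := (pt0 (0 : R) 1, pt1 (0 : R) 1).
by rewrite !mul0r add0r mul1r /in_E /comb !scale0r addr0 add0r.
Qed.

Lemma half_lt : de / 2 < de. Proof. by have := de_gt0; lra. Qed.

Lemma section_strip w : w \in `[- (de / 2), de / 2] -> strip (pt 0 w).
Proof.
rewrite in_itv /= -ler_norml => h.
by rewrite /strip /= pt1; exact: le_lt_trans h half_lt.
Qed.

Lemma section_transversal :
  transversal_segment canal_surface Maximal (c 0) section_of (de / 2).
Proof.
have d0 : 0 < de / 2 by have := de_gt0; lra.
have ds w : section_of^`() w = (den (pt 0 w))^-1 *: E2 (pt 0 w).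
  by rewrite derive1E; have [_ ->] := is_derive_section w.
split.
- exact: d0.
- exact: surf_pt0.
- move=> w w' hw hw' eq.
  have [eL _] := de_inj (ltW (section_strip hw)) (ltW (section_strip hw')) eq.
  by rewrite !pt1 in eL.
- apply: continuous_subspaceT => w.
  rewrite (_ : section_of^`() = fun w => 'D_(pt 0 1) surf (pt 0 w)).
    apply: (@continuous_comp _ _ _ (fun w => pt 0 w) ('D_(pt 0 1) surf)).
      apply: continuous_rowP => j.
      rewrite (_ : (fun y => _) = if j == 0 then fun=> 0 else id); last first.
        by apply/funext => y; rewrite mxE; case: ifP.
      by case: ifP => _; [exact: cvg_cst | exact: cvg_id].
    exact: continuous_derive_surf.
  apply/funext => x; rewrite ds; have [_ ->] := derive_surf_coord (pt 0 x).
  by rewrite /in_E /comb !scale0r addr0 add0r.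
- move=> w hw; have us := section_strip hw; have q0 := den_gt0 (pt 0 w).
  have qn0 : (den (pt 0 w))^-1 != 0 by rewrite invr_neq0 // gt_eqF.
  split.
  + by have [] := is_derive_section w.
  + rewrite ds scaler_eq0 (negbTE qn0) /=; apply/eqP => e2.
    have [[_ h _] _] := oframe_dotp (E_oframe (pt 0 w)).
    by move: h; rewrite e2 dotpE !mxE !mul0r !addr0 => /eqP; rewrite eq_sym oner_eq0.
  + by exists (pt 0 w); [exact: us|].
  + exact: not_umbilic us.
  + by rewrite ds; exact: not_principal_vector_E2 us qn0.
Qed.

(** The leaves near c are followed in the direction of c. *)
Lemma E1_dotp_t w : `|w| * (`|gamma 0| + 1) < 1 -> 0 < dotp (E1 (pt 0 w)) (t 0).
Proof.
have arith (q x y b g : R) : 0 < q -> q = 1 + y ^+ 2 * (b ^+ 2 + g ^+ 2) ->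
    `|y| * (`|g| + 1) < 1 ->
    x = 1 - 2 * g * (y ^+ 2 * g / q) -> 0 < x.
  move=> q0 qE h ->.
  have h' : (y * g) ^+ 2 < 1.
    rewrite -(@real_normK _ (y * g)) ?num_real // expr_lt1 // normrM.
    have := normr_ge0 y; have := normr_ge0 g; move: h; rewrite mulrDr mulr1; lra.
  have -> : 1 - 2 * g * (y ^+ 2 * g / q) = (q - 2 * (y * g) ^+ 2) / q.
    by field; rewrite gt_eqF.
  apply: divr_gt0 => //; rewrite qE.
  have : 0 <= (y * b) ^+ 2 by exact: sqr_ge0.
  by move: h'; rewrite !exprMn mulrDr; lra.
move=> hw; have [p0 p1] := (pt0 0 w, pt1 0 w).
apply: (arith _ _ w (beta 0) (gamma 0) (den_gt0 (pt 0 w)) _ hw).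
  by rewrite denE p0 p1.
by have := E1_dotp (pt 0 w); rewrite p0 p1.
Qed.

(** The return time is exactly L: a leaf is a graph over the arc length, and points
    whose first coordinates differ by less than L are different. *)
Lemma leaf_first_return : \forall w \near (0 : R), w \in `[- (de / 2), de / 2] /\
  first_return canal_surface Maximal section_of (de / 2) (t 0) (fun w => leaf_coord w L) w.
Proof.
have d0 : 0 < de / 2 by have := de_gt0; lra.
have L0 := L_gt0.
have arith (x z : R) : 0 < x -> x < L -> 0 = x + z -> `|z| < L.
  by move=> *; rewrite ltr_norml; apply/andP; split; lra.
have g1 : 0 < (`|gamma 0| + 1)^-1 by rewrite invr_gt0 ltr_wpDl.
near=> w.
have w1 : `|w| < de / 2 by near: w; exact: near0_norm_lt.
have w2 : `|w| < (`|gamma 0| + 1)^-1 by near: w; exact: near0_norm_lt.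
have h : forall s, s \in `[0, L] -> 1 - w * J s != 0 /\ `|leaf_coord w s| < de / 2.
  by near: w; exact: leaf_coord_small.
have h1 s : s \in `[0, L] -> 1 - w * J s != 0 by move=> /h[].
have h2 s : s \in `[0, L] -> `|leaf_coord w s| < de.
  by move=> /h[_ /lt_trans]; apply; exact: half_lt.
have L00 : 0 \in `[0, L] by rewrite in_itv /= lexx ltW.
have LLL : L \in `[0, L] by rewrite in_itv /= lexx ltW.
split; first by rewrite in_itv /= -ler_norml ltW.
exists L, (leaf w); split.
- exact: L0.
- exact: leaf_principal_arc h1 h2.
- have [_ e] := is_derive_leaf (h1 _ L00); rewrite derive1E e leaf_coord0 dotpZl.
  apply: mulr_gt0.
    by apply: de_speed; rewrite pt1 ltW // (lt_trans w1) // half_lt.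
  by apply: E1_dotp_t; rewrite -ltr_pdivlMr ?div1r // ltr_wpDl.
- split.
  + by rewrite /leaf leaf_coord0.
  + rewrite /leaf /section_of.
    by have [[-> _ _ _] _] := same_point_eq (same_point_0L (leaf_coord w L)).
  + by rewrite in_itv /= -ler_norml ltW //; have [] := h _ LLL.
- move=> s w' s0L w'd eq.
  have sL : s \in `[0, L] by move: s0L; rewrite !in_itv /= => /andP[/ltW -> /ltW ->].
  have us : `|Lof (pt s (leaf_coord w s))| <= de.
    by rewrite (pt1 s (leaf_coord w s)); exact: ltW (h2 _ sL).
  have [_ [m]] := de_inj us (ltW (section_strip w'd)) eq.
  rewrite !pt0 => e.
  move: s0L; rewrite in_itv /= => /andP[s0 sl].
  have m0 : m = 0 by exact: int_mulL_eq0 (arith _ _ s0 sl e).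
  by move: s0; rewrite e m0 mul0r addr0 ltxx.
Unshelve. all: by end_near. Qed.

(** G + kn' + kn has derivative kn' (1 - exp (kn')) <= 0, and it increases by G (L)
    over a period. If G (L) = 0 it is periodic and nonincreasing, hence constant,
    and kn' = 0 everywhere. *)
Lemma holonomy_neq0 : (exists s, kn^`() s != 0) -> G L != 0.
Proof.
move=> [s1 n1]; apply/negP => /eqP GL0.
have L0 := L_gt0.
have sgn (x : R) : x * (1 - expR x) <= 0.
  have [x0|x0] := leP 0 x.
    by rewrite mulr_ge0_le0 // subr_le0 -expR0 ler_expR.
  by rewrite mulr_le0_ge0 ?ltW // subr_gt0 -expR0 ltr_expR.
pose F s := G s + kn^`() s + kn s.
have dF s : is_derive s (1 : R) F (kn^`() s * (1 - expR (kn^`() s))).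
  have h := is_deriveD' (is_deriveD' (dG s) (smooth_is_derive smooth_kn' s))
    (smooth_is_derive (bf_smooth_curv bf).2 s).
  by apply: (is_derive_eq h); rewrite gammaE; field.
have Fle (x y : R) : x <= y -> F y <= F x.
  move=> xy; have [|z _ eF] := @MVT_segment R F _ x y xy (fun s _ => dF s).
    apply: continuous_subspaceT => s; apply: differentiable_continuous.
    by apply/derivable1_diffP; have [] := dF s.
  by rewrite -subr_le0 eF mulr_le0_ge0 // subr_ge0.
have pkn := (bf_periodic_curv bf).2; have pkn' := derive1_periodic pkn.
have FL s : F (s + L) = F s.
  have pg : trigo.periodic (fun s => 2 * gamma s) L.
    by move=> x; have [_ pg _] := periodic_beta_gamma; rewrite pg.
  have GE : G (s + L) = G s.
    apply/eqP; rewrite -subr_eq0 (primitive_increment pg dG s 0).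
    by rewrite add0r GL0 G0 subrr.
  by rewrite /F GE pkn pkn'.
(* A period centred at s1, so that F is constant on a neighbourhood of s1. *)
have Fcst x : s1 - L / 2 <= x <= s1 + L / 2 -> F x = F s1.
  move=> /andP[x1 x2].
  have e : F (s1 - L / 2) = F (s1 + L / 2).
    by rewrite -(FL (s1 - L / 2)); congr F; field.
  have arith1 : s1 - L / 2 <= s1 by lra.
  have arith2 : s1 <= s1 + L / 2 by lra.
  apply: le_anti; apply/andP; split.
    by apply: le_trans (Fle _ _ x1) _; rewrite e; exact: Fle.
  by apply: le_trans (Fle _ _ arith1) _; rewrite e; exact: Fle.
have [_ D0] := dF s1.
have : 'D_1 F s1 = 'D_1 (fun=> F s1) s1.
  apply: near_eq_derive; near=> x; apply: Fcst.
  have : `|s1 - x| < L / 2 by near: x; apply: cvgr_dist_lt => //; rewrite divr_gt0.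
  by rewrite ltr_norml => /andP[? ?]; apply/andP; split; lra.
rewrite D0 derive_cst => /eqP; rewrite mulf_eq0 (negbTE n1) /= subr_eq0 eq_sym.
by rewrite -expR0 (inj_eq (@expR_inj R)) (negbTE n1).
Unshelve. all: by end_near. Qed.

Hypothesis GL : G L != 0.

Lemma canal_hyperbolic : hyperbolic_principal_cycle canal_surface L c.
Proof.
exists Maximal; split.
  split; [exact: L_gt0 | by have [] := bf_periodic bf |].
  rewrite (_ : c = leaf 0); last first.
    by apply/funext => s; rewrite /leaf /leaf_coord !mul0r surf_pt0.
  apply: leaf_principal_arc => s _; first by rewrite mul0r subr0 oner_neq0.
  by rewrite /leaf_coord !mul0r normr0.
exists 0, (de / 2), section_of, (fun w => leaf_coord w L); split.
- exact: section_transversal.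
- exact: leaf_first_return.
- by rewrite /leaf_coord !mul0r.
- by have [] := is_derive_leaf_coord_L.
- rewrite derive1E; have [_ ->] := is_derive_leaf_coord_L.
  by rewrite -expR0 (inj_eq (@expR_inj R)) oppr_eq0.
Qed.

End CanalSurface.

(** * The theorem *)

Theorem theorem3 (R : realType) (L : R) (c : R -> 'rV[R]_3)
    (hc : closed_Frenet_curve L c)
    (htau : exists2 s : R, s \in `[0, L] & torsion c s != 0)
    (hint : exists m : int,
       \int[lebesgue_measure]_(s in `[0, L]) torsion c s = 2 * m%:~R * pi)
    (r : nat) (hr : (4 <= r)%N) :
  exists S : oriented_surface R r,
    [set c s | s in `[0, L]] `<=` S /\ hyperbolic_principal_cycle S L c.
Proof.
have [W [N [kg [kn [bf [s1 _ kn1]]]]]] := exists_bishop_frame hc hint htau.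
have Cga : smooth (gamma kn) by exact: smooth_gamma bf.
have [G [dG G0]] :
    exists G, (forall s, is_derive s (1 : R) G (2 * gamma kn s)) /\ G 0 = 0.
  apply: exists_primitive0; apply: (@smooth_continuous R) => k.
  by apply: CkM; [exact: Ck_cst | exact: Cga].
have CG : smooth G.
  case=> [|i]; [apply: CkW|]; apply: (Ck1 dG); apply: CkM; do ?exact: Ck_cst; exact: Cga.
have [J [dJ J0]] : exists J,
    (forall s, is_derive s (1 : R) J (gamma kn s * kg s * expR (- G s))) /\ J 0 = 0.
  apply: exists_primitive0; apply: (@smooth_continuous R) => k.
  apply: CkM; first by apply: CkM; [exact: Cga | exact: (bf_smooth_curv bf).1].
  by apply: Ck_expR; apply: CkN; exact: CG.
have GL : G L != 0 by apply: (holonomy_neq0 bf hc dG G0); exists s1.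
have [d d0 [inj sg]] := exists_strip bf hc.
exists (canal_surface bf hc inj sg r); split.
  move=> p [s _ <-]; exists (pt s 0); last exact: surf_pt0.
  by rewrite /strip /= pt1 normr0.
exact: (canal_hyperbolic bf hc d0 inj sg r dG G0 dJ J0 GL).
Qed.
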